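(* Let $n,k,m$ be positive integers with $1\le k\le n$, $1\le m\le n$ and $n+1\le m+k$, and let $\lambda=(m^{n-m+1},m-1,\dots,n-k+1)$, i.e. $(i,j)\in\lambda$ if and only if $1\le i\le k$, $1\le j\le m$ and $i+j\le n+1$. Then the following identities of formal power series hold. 1. If $k\le m$, then $$\prod_{(i,j)\in\lambda}(1-x_iy_j)^{-1}=\sum_{\mu\in\mathbb{N}^k}\widehat{\kappa}_{\mu}(x)\,\pi_{\sigma(\lambda,SE)}\kappa_{\omega\mu}(y)=\sum_{\mu\in\mathbb{N}^k}\widehat{\kappa}_{\mu}(x)\,\kappa_{(0^{m-k},\alpha)}(y),$$ where, for each $\mu\in\mathbb{N}^k$, $\alpha=(\alpha_1,\dots,\alpha_k)\in\mathbb{N}^k$ is the weak composition such that for $i=k,k-1,\dots,1$ the entry $\alpha_i$ is the maximum among the last $\min\{i,n-m+1\}$ entries of $\omega\mu$ after deleting $\alpha_j$ for $i<j\le k$. 2. If $m\le k$, then $$\prod_{(i,j)\in\lambda}(1-x_iy_j)^{-1}=\sum_{\mu\in\mathbb{N}^m}\bigl(\pi_{\sigma(\lambda,NW)}\widehat{\kappa}_{\mu}(x)\bigr)\kappa_{\omega\mu}(y)=\sum_{\mu\in\mathbb{N}^m}\widehat{\kappa}_{\mu}(y)\,\pi_{\sigma(\lambda,NW)}\kappa_{\omega\mu}(x)=\sum_{\mu\in\mathbb{N}^m}\kappa_{(0^{k-m},\alpha')}(x)\,\widehat{\kappa}_{\mu}(y),$$ where, for each $\mu\in\mathbb{N}^m$,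 $\alpha'=(\alpha'_1,\dots,\alpha'_m)\in\mathbb{N}^m$ is the weak composition such that for $i=m,m-1,\dots,1$ the entry $\alpha'_i$ is the maximum among the last $\min\{i,n-k+1\}$ entries of $\omega\mu$ after deleting $\alpha'_j$ for $i<j\le m$.
   Context: $\mathbb{N}$ includes $0$; $x=(x_1,\dots,x_n)$ and $y=(y_1,\dots,y_n)$ are two sequences of indeterminates. For a weak composition $\mu$, $\omega\mu$ denotes $\mu$ written in reverse order. Concatenation of weak compositions is written $(\alpha,\beta)$, and $0^r$ means $r$ zeros. A weak composition with fewer than $n$ entries is regarded as an element of $\mathbb{N}^n$ by appending zeros on the right. Isobaric divided differences. For $1\le i<n$ and a polynomial $f$ in $z_1,\dots,z_n$ ($z=x$ or $z=y$), let $s_if$ be $f$ with $z_i,z_{i+1}$ exchanged, and $$\pi_i f=\frac{z_if-s_i(z_if)}{z_i-z_{i+1}},\qquad \widehat{\pi}_if=\pi_if-f .$$ Both families satisfy the braid and commutation relations, so for $\sigma\in\mathfrak{S}_n$ with reduced decomposition $\sigma=s_{i_N}\cdots s_{i_1}$ the operators $\pi_\sigma=\pi_{i_N}\cdots\pi_{i_1}$ and $\widehat\pi_\sigma=\widehat\pi_{i_N}\cdots\widehat\pi_{i_1}$ (rightmost acts first) are well defined. An operator acts on the variables of the polynomial to which it is applied. Key polynomials (Demazure characters) $\kappa_\alpha$ and Demazure atoms $\widehat\kappa_\alpha$, $\alpha\in\mathbb{N}^n$: if $\alpha$ is a partition (weakly decreasing), $\kappa_\alpha(z)=\widehat\kappa_\alpha(z)=z^\alpha=z_1^{\alpha_1}\cdots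 z_n^{\alpha_n}$; otherwise, for any $i$ with $\alpha_i<\alpha_{i+1}$, $\kappa_\alpha=\pi_i\kappa_{s_i\alpha}$ and $\widehat\kappa_\alpha=\widehat\pi_i\widehat\kappa_{s_i\alpha}$, where $s_i\alpha$ is $\alpha$ with entries $i$ and $i+1$ exchanged. The permutations. If $k\le m$, $$\sigma(\lambda,SE)=\prod_{i=1}^{k-(n-m)-1}(s_{i+n-k-1}\cdots s_{i+1}s_i)\ \prod_{i=0}^{n-m}(s_{m-1}\cdots s_{k-(n-m)+i}),$$ where products over $i$ are written from left to right in increasing $i$, each parenthesis has indices decreasing by one from left to right, and is empty (identity) if its first index is smaller than its last index. (Equivalently: in the French-convention Ferrers diagram of $\lambda$, with the staircase $\rho=(k,k-1,\dots,1)$ removed, fill each cell of column $c$ with $c-1$, and read the rows from top to bottom, each from right to left, interpreting $r$ as the transposition $s_r=(r\ r{+}1)$.) If $m\le k$, $\sigma(\lambda,NW)$ is given by the same formula with $k$ and $m$ interchanged, i.e. $\sigma(\lambda,NW)=\sigma(\overline\lambda,SE)$ with $\overline\lambda$ the conjugate partition. The displayed words are reduced. In the definition of $\alpha$ (and $\alpha'$), ''deleting $\alpha_j$'' means removing from the sequence $\omega\mu$ the entry which was selected as $\alpha_j$ (one occurrence), so that $i$ entries remain when $\alpha_i$ is chosen; among them the last $\min\{i,n-m+1\}$ (resp. $\min\{i,n-k+1\}$) are considered. *)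

(* Defs.v *)
From HB Require Import structures.
From mathcomp Require Import all_boot all_order all_fingroup all_algebra.
From mathcomp Require Import zify.
From mathcomp Require Export mpoly.

Set Implicit Arguments.
Unset Strict Implicit.
Unset Printing Implicit Defensive.

Import GRing.Theory.
Local Open Scope ring_scope.

(** Polynomials and power series have coefficients in [int]. *)

(** ** Formal power series in [N] variables, as coefficient functions *)

Definition fps (N : nat) := 'X_{1..N} -> int.

Section FormalPowerSeries.
Variable N : nat.
Implicit Types (f g : fps N) (m : 'X_{1..N}).

Definition fps_of_mpoly (p : {mpoly int[N]}) : fps N := fun m => p@_m.

Definition fps_one : fps N := fps_of_mpoly 1.

(* Cauchy product; same shape as [mcoeffM]. *)
Definition fps_mul f g : fps N := fun m =>
  \sum_(k : 'X_{1..N < (mdeg m).+1, (mdeg m).+1} | m == (k.1 + k.2)%MM)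
     f k.1 * g k.2.

(* The inverse sum_k (1 - f)^k of a series [f] with constant coefficient 1;
   (1 - f)^k has no term of degree < k, so the sum is finite at each [m]. *)
Definition fps_inv f : fps N := fun m =>
  \sum_(k < (mdeg m).+1)
     iter k (fps_mul (fun m' => fps_one m' - f m')) fps_one m.

(* [S] is the sum of the (possibly infinite) family [F]: every coefficient is
   nonzero for finitely many members only, and these add up to that of [S]. *)
Definition fps_has_sum (I : eqType) (F : I -> fps N) (S : fps N) : Prop :=
  forall m, exists2 s : seq I,
    uniq s /\ (forall i, F i m != 0 -> i \in s) & S m = \sum_(i <- s) F i m.

Lemma fps_mul_mpoly f g (p q : {mpoly int[N]}) m :
    (forall m', (mdeg m' <= mdeg m)%N -> f m' = p@_m') ->
    (forall m', (mdeg m' <= mdeg m)%N -> g m' = q@_m') ->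
  fps_mul f g m = (p * q)@_m.
Proof.
move=> fp gq; rewrite mcoeffM; apply: eq_bigr => -[a b] /= _.
by rewrite fp ?gq // -ltnS bmdeg.
Qed.

Lemma fps_mulV f : f 0%MM = 1 -> fps_mul f (fps_inv f) =1 fps_one.
Proof.
move=> f0 m; pose d := mdeg m.
pose u : fps N := fun m' => fps_one m' - f m'.
pose U : {mpoly int[N]} := \sum_(a : 'X_{1..N < d.+1}) u a *: 'X_[a].
have uU m' : (mdeg m' <= d)%N -> u m' = U@_m'.
  move=> le_m'd; rewrite /U raddf_sum (bigD1 (BMultinom (le_m'd : mdeg m' < d.+1)%N)) //=.
  rewrite mcoeffZ mcoeffX eqxx mulr1 big1 ?addr0 // => a ne_a.
  rewrite mcoeffZ mcoeffX; case: eqP => [eq_a|]; last by rewrite mulr0.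
  by case/eqP: ne_a; apply: val_inj.
have uX k m' : (mdeg m' <= d)%N -> iter k (fps_mul u) fps_one m' = (U ^+ k)@_m'.
  elim: k m' => [//|k IHk] m' le_m'd; rewrite exprS /=.
  apply: fps_mul_mpoly => a le_am'; first by apply/uU/(leq_trans le_am').
  exact/IHk/(leq_trans le_am').
have U0 : U@_0%MM = 0 by rewrite -uU ?mdeg0 // /u f0 /fps_one /fps_of_mpoly mcoeff1 eqxx subrr.
have UX0 k m' : (mdeg m' < k)%N -> (U ^+ k)@_m' = 0.
  elim: k m' => [//|k IHk] m'; rewrite ltnS => le_m'k; rewrite exprS mcoeffM.
  apply: big1 => -[a b] /= /eqP def_m'.
  have [a0|nz_a] := eqVneq (val a) 0%MM; first by rewrite a0 U0 mul0r.
  rewrite IHk ?mulr0 //; apply: leq_trans le_m'k.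
  have def_d : mdeg m' = (mdeg a + mdeg b)%N by rewrite -mdegD -def_m'.
  by apply: leq_trans (eq_leq (esym def_d)); rewrite -add1n leq_add2r lt0n mdeg_eq0.
rewrite (@fps_mul_mpoly _ _ (1 - U) (\sum_(k < d.+1) U ^+ k)).
- rewrite -opprB mulNr -subrX1 opprB mcoeffB UX0 ?subr0 //.
- by move=> m' le; rewrite mcoeffB -uU // /u /fps_one /fps_of_mpoly opprB addrC subrK.
move=> m' le; rewrite /fps_inv raddf_sum /=.
rewrite (big_ord_widen d.+1 (fun k => iter k (fps_mul u) fps_one m')) ?ltnS //.
rewrite big_mkcond /=; apply: eq_bigr => k _; rewrite -uX //.
by case: ltnP => // ?; rewrite uX // UX0.
Qed.

End FormalPowerSeries.

(** ** Simple transpositions and isobaric divided differences *)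

Section Operators.
Variable n : nat.
Implicit Types (r : 'I_n.-1) (f : {mpoly int[n]}) (a : 'X_{1..n}).

(* [r : 'I_n.-1] stands for the generator s_(r+1), which exchanges the entries
   with 1-based positions r+1 and r+2, i.e. the ordinals [lo r] and [hi r]. *)
Definition lo r : 'I_n := widen_ord (leq_pred n) r.

Lemma hi_subproof r : (r.+1 < n)%N.
Proof. by case: n r => [[]//|n'] r /=; rewrite ltnS. Qed.

Definition hi r : 'I_n := Ordinal (hi_subproof r).

(* As in mpoly.v. *)
Local Notation "m # s" := [multinom m (s i) | i < n]
  (at level 40, left associativity, format "m # s").

Definition simple_tperm r : 'S_n := tperm (lo r) (hi r).

Lemma isobaric_subproof r f :
  exists g, ('X_(lo r) - 'X_(hi r)) * g
            == 'X_(lo r) * f - msym (simple_tperm r) ('X_(lo r) * f).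
Proof.
pose P (h : {mpoly int[n]}) := exists g, ('X_(lo r) - 'X_(hi r)) * g = h - msym (simple_tperm r) h.
suff /(_ ('X_(lo r) * f)) [g def_g] : forall h, P h by exists g; apply/eqP.
have PM h h' : P h -> P h' -> P (h * h').
  move=> [g def_g] [g' def_g']; exists (h * g' + g * msym (simple_tperm r) h').
  by rewrite mulrDr mulrCA def_g' mulrA def_g msymM mulrBr mulrBl addrA subrK.
have P1 : P 1 by exists 0; rewrite mulr0 msym1 subrr.
have PX i : P 'X_i.
  rewrite /P msymX; have -> : U_(i)%MM # ((simple_tperm r)^-1)%g = U_(simple_tperm r i)%MM.
    apply/mnmP=> j; rewrite !mnmE; congr nat_of_bool.
    by rewrite -[in RHS](inj_eq (@perm_inj _ ((simple_tperm r)^-1)%g)) permK.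
  rewrite /simple_tperm; case: tpermP => [->|->|_ _]; first by exists 1; rewrite mulr1.
    by exists (-1); rewrite mulrN1 opprB.
  by exists 0; rewrite mulr0 subrr.
elim/mpolyind => [|c m h _ _ [g def_g]]; first by exists 0; rewrite mulr0 msym0 subrr.
have [g' def_g'] : P 'X_[m].
  rewrite mpolyXE_id; elim/big_ind: _ => // i _.
  by elim: (m i) => [|d IHd]; [rewrite expr0 | rewrite exprS; apply: PM].
exists (c *: g' + g); rewrite mulrDr -scalerAr def_g def_g' msymD msymZ.
by rewrite scalerBr opprD addrACA.
Qed.

(* The quotient (z_i f - s_i (z_i f)) / (z_i - z_(i+1)), unique since
   {mpoly int[n]} is an integral domain. *)
Definition isobaric r f : {mpoly int[n]} := xchoose (isobaric_subproof r f).

Lemma isobaricE r f :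
  ('X_(lo r) - 'X_(hi r)) * isobaric r f
  = 'X_(lo r) * f - msym (simple_tperm r) ('X_(lo r) * f).
Proof. exact/eqP/(xchooseP (isobaric_subproof r f)). Qed.

Definition isobaric_hat r f : {mpoly int[n]} := isobaric r f - f.

(** ** Operators indexed by permutations *)

(* The word [:: r_N; ...; r_1] denotes the composite s_(r_N) o ... o s_(r_1);
   the product of permutations in MathComp applies its left factor first. *)
Definition word_perm (w : seq 'I_n.-1) : 'S_n :=
  (\prod_(r <- rev w) simple_tperm r)%g.

Definition reduced_word (s : 'S_n) (w : seq 'I_n.-1) : bool :=
  (word_perm w == s) &&
  [forall l : 'I_(size w), forall t : l.-tuple 'I_n.-1, word_perm t != s].

Lemma reduced_wordP s w :
  reflect (word_perm w = s /\
           forall w', word_perm w' = s -> (size w <= size w')%N)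
          (reduced_word s w).
Proof.
apply: (iffP andP) => -[/eqP def_s min_w]; split=> //.
  move=> w' def_s'; rewrite leqNgt; apply/negP=> lt_w'w.
  have /forallP/(_ (in_tuple w')) := forallP min_w (Ordinal lt_w'w).
  by rewrite /= def_s' eqxx.
apply/forallP=> l; apply/forallP=> t; apply/eqP=> /min_w.
by rewrite size_tuple leqNgt ltn_ord.
Qed.

Lemma reduced_word_exists (s : 'S_n) : exists w, reduced_word s w.
Proof.
pose P t := exists w, word_perm w = t.
have PM t t' : P t -> P t' -> P (t * t')%g.
  move=> [w <-] [w' <-]; exists (w' ++ w).
  by rewrite /word_perm rev_cat big_cat.
have P1 : P 1%g by exists [::]; rewrite /word_perm big_nil.
have Ps r : P (simple_tperm r) by exists [:: r]; rewrite /word_perm big_seq1.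
have Pij d (i j : 'I_n) : (j = i + d :> nat)%N -> P (tperm i j).
  elim: d j => [|d IHd] j def_j.
    by rewrite (_ : j = i) ?tperm1 //; apply: val_inj; rewrite /= def_j addn0.
  have lt_r : (i + d < n.-1)%N by have := ltn_ord j; lia.
  pose r := Ordinal lt_r.
  have hi_r : hi r = j by apply: val_inj; rewrite /= def_j addnS.
  have [->|ne_ij] := eqVneq i j; first by rewrite tperm1.
  have [d0|d_gt0] := posnP d.
    rewrite (_ : tperm i j = simple_tperm r) //; congr tperm => //.
    by apply: val_inj; rewrite /= d0 addn0.
  rewrite (_ : tperm i j = simple_tperm r * (tperm i (lo r) * simple_tperm r))%g.
    by apply: (PM _ _ (Ps r) (PM _ _ _ (Ps r))); apply: IHd.
  have := tpermJ i (lo r) (simple_tperm r); rewrite conjgE tpermV => ->.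
  rewrite /simple_tperm tpermL hi_r tpermD //.
    by rewrite -val_eqE /=; lia.
  by rewrite eq_sym.
have [w0 def_s] : P s.
  have [ts -> _] := prod_tpermP s; elim/big_ind: _ => // -[i j] _ /=.
  have [le_ij|/ltnW le_ji] := leqP i j; first by apply: (Pij (j - i)%N); rewrite subnKC.
  by rewrite tpermC; apply: (Pij (i - j)%N); rewrite subnKC.
have ex_l : exists l, [exists t : l.-tuple 'I_n.-1, word_perm t == s].
  by exists (size w0); apply/existsP; exists (in_tuple w0); rewrite /= def_s.
case: (ex_minnP ex_l) => l /existsP[t /eqP def_t] min_l; exists t.
apply/reduced_wordP; split=> // w' def_w'; rewrite size_tuple; apply: min_l.
by apply/existsP; exists (in_tuple w'); rewrite /= def_w'.
Qed.

(* By the braid and commutation relations the choice of the reduced word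
   is immaterial. *)
Definition isobaric_perm (s : 'S_n) f : {mpoly int[n]} :=
  foldr isobaric f (xchoose (reduced_word_exists s)).

(** ** Key polynomials and Demazure atoms *)

(* Recursion on [fuel]; each step replaces [a] by the exponent with an ascent
   exchanged, which lowers [ascent_weight], so that the fuel in [key] and [atom]
   suffices (see [keyE] and [atomE]).  By the braid and commutation relations
   the choice of the ascent is immaterial. *)
Fixpoint demazure_rec (op : 'I_n.-1 -> {mpoly int[n]} -> {mpoly int[n]})
    (fuel : nat) (a : 'X_{1..n}) : {mpoly int[n]} :=
  if fuel is fuel'.+1 then
    if [pick r | (a (lo r) < a (hi r))%N] is Some r
    then op r (demazure_rec op fuel' (a # simple_tperm r))
    else 'X_[a]
  else 'X_[a].

Definition ascent_weight a : nat := (\sum_(i < n) i * a i)%N.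

Definition key a := demazure_rec isobaric (ascent_weight a) a.
Definition atom a := demazure_rec isobaric_hat (ascent_weight a) a.

Lemma ascent_weight_lt a r :
  (a (lo r) < a (hi r))%N ->
  (ascent_weight (a # simple_tperm r) < ascent_weight a)%N.
Proof.
move=> lt_a; have ne_r : hi r != lo r by rewrite -val_eqE /=; lia.
have wE b : ascent_weight b = (lo r * b (lo r) + (hi r * b (hi r)
    + \sum_(i < n | (i != lo r) && (i != hi r)) i * b i))%N.
  by rewrite /ascent_weight (bigD1 (lo r)) //= (bigD1 (hi r)).
rewrite !wE !mnmE tpermL tpermR; set s := (X in (X < _)%N); set s' := bigop _ _ _.
rewrite (_ : s = lo r * a (hi r) + (hi r * a (lo r) + s'))%N /=; first by nia.
congr (_ + (_ + _))%N; apply: eq_bigr => i /andP[ne_lo ne_hi].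
by rewrite mnmE tpermD // eq_sym.
Qed.

Lemma demazure_rec_fuel op l l' a :
    (ascent_weight a <= l)%N -> (ascent_weight a <= l')%N ->
  demazure_rec op l a = demazure_rec op l' a.
Proof.
elim: l l' a => [|l IHl] [|l'] a //=.
- by rewrite leqn0 => /eqP a0 _; case: pickP => // r /ascent_weight_lt; rewrite a0.
- by rewrite leqn0 => _ /eqP a0; case: pickP => // r /ascent_weight_lt; rewrite a0.
move=> le_al le_al'; case: pickP => // r /ascent_weight_lt lt_a.
by congr (op r _); apply: IHl; rewrite -ltnS (leq_trans lt_a).
Qed.

Lemma demazure_recE op a (F := fun b => demazure_rec op (ascent_weight b) b) :
  F a = if [pick r | (a (lo r) < a (hi r))%N] is Some r
        then op r (F (a # simple_tperm r)) else 'X_[a].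
Proof.
rewrite /F (@demazure_rec_fuel op _ (ascent_weight a).+1) //=.
by case: pickP => // r /ascent_weight_lt/ltnW le_a; congr (op r _); apply: demazure_rec_fuel.
Qed.

Lemma keyE a :
  key a = if [pick r | (a (lo r) < a (hi r))%N] is Some r
          then isobaric r (key (a # simple_tperm r)) else 'X_[a].
Proof. exact: demazure_recE. Qed.

Lemma atomE a :
  atom a = if [pick r | (a (lo r) < a (hi r))%N] is Some r
           then isobaric_hat r (atom (a # simple_tperm r)) else 'X_[a].
Proof. exact: demazure_recE. Qed.

End Operators.

(** ** Combinatorial data *)

(* Weak compositions are sequences; missing entries are zeros. *)
Definition compo (n : nat) (s : seq nat) : 'X_{1..n} :=
  [multinom nth 0%N s i | i < n].

(* [:: a; a - 1; ...; b], empty if a < b. *)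
Definition descending (a b : nat) : seq nat := rev (iota b (a.+1 - b)).

(* The word of sigma(lambda, SE), with generators numbered from 1. *)
Definition sigma_indices (n k m : nat) : seq nat :=
  (flatten [seq descending (i + n - k - 1) i | i <- iota 1 (k - (n - m) - 1)]
   ++ flatten [seq descending (m - 1) (k - (n - m) + i)
                 | i <- iota 0 (n - m).+1])%N.

(* [insub] never fails here, as 1 <= j < n for all [j] in [sigma_indices n k m]
   when k <= m <= n < k + m (see [sigma_indices_bound]). *)
Definition sigma_SE (n k m : nat) : 'S_n :=
  word_perm (pmap (fun j => insub j.-1) (sigma_indices n k m)).

Definition sigma_NW (n k m : nat) : 'S_n := sigma_SE n m k.

Lemma sigma_indices_bound n k m :
    (k <= m)%N -> (m <= n)%N -> (n < k + m)%N ->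
  all (fun j => 0 < j < n)%N (sigma_indices n k m).
Proof.
move=> le_km le_mn lt_n; apply/allP=> j; rewrite mem_cat.
by case/orP=> /flattenP[_ /mapP[i i_in ->]]; rewrite mem_rev mem_iota => j_in;
  move: i_in; rewrite mem_iota => i_in; lia.
Qed.

(* [:: a_1; ...; a_l] where l = size s: a_l is the maximum of the last
   min(l, p) entries of s, and a_1, ..., a_(l-1) are obtained in the same way
   from s with one occurrence of a_l among these entries deleted.  Which of
   several equal maxima is deleted does not affect the result. *)
Fixpoint select_max (p l : nat) (s : seq nat) : seq nat :=
  if l is l'.+1 then
    let start := (l - minn l p)%N in
    let window := drop start s in
    let a := (\max_(b <- window) b)%N in
    rcons (select_max p l' (take start s ++ rem a window)) a
  else [::].

(* alpha for p = n - m + 1, alpha' for p = n - k + 1. *)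
Definition alpha (p : nat) (mu : seq nat) : seq nat :=
  select_max p (size mu) (rev mu).

(** ** The two alphabets: x_i and y_j are variables number i and n + j *)

Section TwoAlphabets.
Variable n : nat.

Definition in_x (f : {mpoly int[n]}) : {mpoly int[n + n]} :=
  f \mPo [tuple 'X_(lshift n i) | i < n].
Definition in_y (f : {mpoly int[n]}) : {mpoly int[n + n]} :=
  f \mPo [tuple 'X_(rshift n i) | i < n].

Definition fps_prod_xy (f g : {mpoly int[n]}) : fps (n + n) :=
  fps_of_mpoly (in_x f * in_y g).

(* (i, j) is in lambda, for 1-based i and j. *)
Definition in_lambda (k m i j : nat) : bool :=
  [&& 1 <= i <= k, 1 <= j <= m & i + j <= n.+1]%N.

Definition cauchy_product (k m : nat) : fps (n + n) :=
  \big[@fps_mul (n + n)/@fps_one (n + n)]_(c : 'I_n * 'I_n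
                                             | in_lambda k m c.1.+1 c.2.+1)
    fps_inv (fps_of_mpoly (1 - in_x 'X_(c.1) * in_y 'X_(c.2))).

End TwoAlphabets.

Arguments cauchy_product : clear implicits.

(* Main.v *)
(** Write pi_i, hat pi_i for the operators in x and y, and t_i = x_i y_(k+1-i).
    For the staircase rho_k the identity is proved by induction on k.  Applying
    hat pi^x_j ... hat pi^x_(k-1) pi^y_(k-j+1) ... pi^y_(k-1) to the kernel of
    rho_(k-1) gives (1 - t_j) t_(j+1) ... t_k times the kernel of rho_k, and
    applied to the expansion for k - 1 it inserts a zero at position j of mu,
    killing the terms in which this would not be the last zero.  Summing over j,
    the products telescope: the terms whose mu has a zero entry add up to
    (1 - x_1...x_k y_1...y_k) times the kernel of rho_k.  The terms with mu > 0
    are x_1...x_k y_1...y_k times the whole sum, which closes the induction.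

    From rho_k to lambda, each factor of the displayed word adds one cell, because
    pi_j turns (1 - x y_j)^-1 into ((1 - x y_j) (1 - x y_(j+1)))^-1.  On key
    polynomials the same factors act as bubble sort steps on the exponent, and a
    pass of bubble sort is an insertion into the window defining alpha.

    Independence of the chosen ascents and reduced words is a confluence
    statement for recursions along ascents of exponents.  Series are replaced by
    their homogeneous components, complete homogeneous polynomials in the
    monomials x_i y_j. *)

Require Import Defs.
From mathcomp Require Import all_boot all_order all_fingroup all_algebra.
From mathcomp Require Import zify ring.

Set Implicit Arguments.
Unset Strict Implicit.
Unset Printing Implicit Defensive.

Import GRing.Theory.

(** * Isobaric divided differences *)

Section RingIdentities.
Local Open Scope ring_scope.
Variable R : comNzRingType.
Implicit Types a b c d : R.

(** The names record operators: [f12] stands for s_1 s_2 f, [s1p2] for s_1 pi_2 f, [p21] for pi_2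
    pi_1 f. The hypotheses are defining equations cleared of denominators; the conclusion says, up
    to the factor [c - d], that [p21] solves the equation defining pi_1 pi_2 f. *)
Lemma isobaric_comm_ring a b c d f f1 f2 f12 p1 p2 s1p2 s2p1 p21 :
  (a - b) * p1 = a * f - b * f1 -> (c - d) * p2 = c * f - d * f2 ->
  (c - d) * s1p2 = c * f1 - d * f12 -> (a - b) * s2p1 = a * f2 - b * f12 ->
  (c - d) * p21 = c * p1 - d * s2p1 ->
  (c - d) * ((a - b) * p21) = (c - d) * (a * p2 - b * s1p2) :> R.
Proof.
move=> e1 e2 e3 e4 e5.
have -> : (c - d) * ((a - b) * p21) = (a - b) * ((c - d) * p21) by ring.
have -> : (c - d) * (a * p2 - b * s1p2)
          = a * ((c - d) * p2) - b * ((c - d) * s1p2) by ring.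
have -> : (a - b) * ((c - d) * p21)
          = c * ((a - b) * p1) - d * ((a - b) * s2p1) by rewrite e5; ring.
by rewrite e1 e2 e3 e4; ring.
Qed.

(* The common value is the antisymmetrisation of [a ^+ 2 * b * f] over the
   symmetric group of [a], [b], [c]. *)
Lemma isobaric_braid_ring a b c f f1 f2 f12 f21 f121
    p1 s2p1 s12p1 p21 s1p21 p121 p2 s1p2 s21p2 p12 s2p12 p212 :
  (a - b) * p1 = a * f - b * f1 -> (a - c) * s2p1 = a * f2 - c * f21 ->
  (b - c) * s12p1 = b * f12 - c * f121 -> (b - c) * p21 = b * p1 - c * s2p1 ->
  (a - c) * s1p21 = a * p1 - c * s12p1 -> (a - b) * p121 = a * p21 - b * s1p21 ->
  (b - c) * p2 = b * f - c * f2 -> (a - c) * s1p2 = a * f1 - c * f12 ->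
  (a - b) * s21p2 = a * f21 - b * f121 -> (a - b) * p12 = a * p2 - b * s1p2 ->
  (a - c) * s2p12 = a * p2 - c * s21p2 ->
  (b - c) * p212 = b * p12 - c * s2p12 ->
  (a - b) * (a - c) * (b - c) * p121 = (a - b) * (a - c) * (b - c) * p212 :> R.
Proof.
move=> e1 e2 e3 e4 e5 e6 h1 h2 h3 h4 h5 h6.
transitivity (a * b * (a * f - b * f1) - a * c * (a * f2 - c * f21)
              + b * c * (b * f12 - c * f121)).
  transitivity ((a - c) * (b - c) * ((a - b) * p121)); first by ring.
  rewrite e6; transitivity (a * (a - c) * ((b - c) * p21)
                            - b * (b - c) * ((a - c) * s1p21)); first by ring.
  rewrite e4 e5; transitivity (a * b * ((a - b) * p1)
    - a * c * ((a - c) * s2p1) + b * c * ((b - c) * s12p1)); first by ring.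
  by rewrite e1 e2 e3.
transitivity ((a - c) * (a - b) * ((b - c) * p212)); last by ring.
rewrite h6; transitivity (b * (a - c) * ((a - b) * p12)
                          - c * (a - b) * ((a - c) * s2p12)); last by ring.
rewrite h4 h5; transitivity (a * a * ((b - c) * p2)
  - b * b * ((a - c) * s1p2) + c * c * ((a - b) * s21p2)); last by ring.
by rewrite h1 h2 h3; ring.
Qed.

Lemma sub_sub_swap a b c d : a - b - (c - d) = a - c - (b - d).
Proof. by ring. Qed.

(** As p p = p, the product (p - 1)(q - 1)(p - 1) expands to p q p - p q - q p + p + q - 1, where
    only p q p is not symmetric in p and q. *)
Lemma hat_braid (p q : R -> R) a (hat := fun (g : R -> R) x => g x - x) :
  {morph p : x y / x - y} -> {morph q : x y / x - y} ->
  (forall x, p (p x) = p x) -> (forall x, q (q x) = q x) ->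
  p (q (p a)) = q (p (q a)) ->
  hat p (hat q (hat p a)) = hat q (hat p (hat q a)).
Proof. by move=> pB qB pp qq; rewrite /hat !(pB, qB) pp qq => ->; ring. Qed.

End RingIdentities.

Section IsobaricTheory.
Local Open Scope ring_scope.

Lemma msymXU n (s : 'S_n) i : msym s 'X_i = 'X_(s i) :> {mpoly int[n]}.
Proof.
rewrite msymX; congr ('X_[_]); apply/mnmP=> j; rewrite !mnmE; congr nat_of_bool.
by rewrite -[in RHS](inj_eq (@perm_inj _ (s^-1)%g)) permK.
Qed.

Variable n : nat.
Implicit Types (r : 'I_n.-1) (f g : {mpoly int[n]}) (a : 'X_{1..n}).
Local Notation sw r := (@msym n int (simple_tperm r)).
Local Notation lo := (@lo n).
Local Notation hi := (@hi n).

Lemma lo_neq_hi r : lo r != hi r.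
Proof. by rewrite -val_eqE /= neq_ltn ltnSn. Qed.

Lemma simple_tperm_comm r r' : (r.+1 < r')%N ->
  (simple_tperm r * simple_tperm r' = simple_tperm r' * simple_tperm r)%g.
Proof.
move=> lt_rr'; rewrite [in LHS]conjgC /simple_tperm tpermJ !tpermD //;
  by rewrite -val_eqE /=; lia.
Qed.

Lemma simple_tperm_braid r r' : r' = r.+1 :> nat ->
  (simple_tperm r * simple_tperm r' * simple_tperm r
   = simple_tperm r' * simple_tperm r * simple_tperm r')%g.
Proof.
move=> def_r'; have lo_r' : lo r' = hi r by apply: val_inj.
have n1 := lo_neq_hi r; have n2 := lo_neq_hi r'; rewrite lo_r' in n2.
have n3 : lo r != hi r' by rewrite -val_eqE /= def_r' neq_ltn; lia.
rewrite /simple_tperm lo_r'.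
have := tpermJ (lo r) (hi r) (tperm (hi r) (hi r')).
have := tpermJ (hi r) (hi r') (tperm (lo r) (hi r)).
by rewrite !conjgE !tpermV !mulgA tpermL tpermR !tpermD // 1?eq_sym // => -> ->.
Qed.

Lemma msym_lo r : sw r 'X_(lo r) = 'X_(hi r).
Proof. by rewrite msymXU tpermL. Qed.

Lemma msym_hi r : sw r 'X_(hi r) = 'X_(lo r).
Proof. by rewrite msymXU tpermR. Qed.

Lemma msym_simple_tpermK r : involutive (sw r).
Proof. by move=> f; rewrite -msymMm tperm2 msym1m. Qed.

Lemma subX_neq0 (i j : 'I_n) : i != j -> 'X_i - 'X_j != 0 :> {mpoly int[n]}.
Proof.
move=> ne_ij; apply/eqP=> /(congr1 (mcoeff U_(i))).
rewrite mcoeffB !mcoeffX mcoeff0 eqxx; case: eqP => // /mnmP/(_ i).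
by rewrite !mnmE eqxx eq_sym (negPf ne_ij).
Qed.

Lemma isobaric_divE r f :
  ('X_(lo r) - 'X_(hi r)) * isobaric r f = 'X_(lo r) * f - 'X_(hi r) * sw r f.
Proof. by rewrite isobaricE msymM msym_lo. Qed.

(** Cancelling x_r - x_(r+1) reduces identities between divided differences to identities between
    numerators. *)
Lemma isobaric_unique r f g :
  ('X_(lo r) - 'X_(hi r)) * g = 'X_(lo r) * f - 'X_(hi r) * sw r f ->
  isobaric r f = g.
Proof.
rewrite -isobaric_divE => eq_g.
by apply: (mulfI (subX_neq0 (lo_neq_hi r))); rewrite eq_g.
Qed.

Lemma isobaricD r : {morph isobaric r : f g / f + g}.
Proof.
move=> f g; apply: isobaric_unique; apply: etrans (mulrDr _ _ _) _.
apply: etrans (congr2 +%R (isobaric_divE r f) (isobaric_divE r g)) _.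
by rewrite addrACA -opprD -!mulrDr -msymD.
Qed.

Lemma isobaric0 r : isobaric r 0 = 0.
Proof. by apply: isobaric_unique; rewrite msym0 !mulr0 subrr. Qed.

Lemma isobaricN r : {morph isobaric r : f / - f}.
Proof.
move=> f; apply: isobaric_unique; rewrite mulrN isobaric_divE msymN.
by rewrite !mulrN opprB opprK addrC.
Qed.

Lemma isobaricB r : {morph isobaric r : f g / f - g}.
Proof. by move=> f g; rewrite isobaricD isobaricN. Qed.

Lemma isobaricM r f g : sw r g = g -> isobaric r (g * f) = g * isobaric r f.
Proof.
move=> sg; apply: isobaric_unique; rewrite mulrCA isobaric_divE msymM sg.
by rewrite mulrBr !(mulrCA g).
Qed.

Lemma isobaric_hatM r f g :
  sw r g = g -> isobaric_hat r (g * f) = g * isobaric_hat r f.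
Proof. by move=> sg; rewrite /isobaric_hat isobaricM // mulrBr. Qed.

Lemma isobaric_fix r f : sw r f = f -> isobaric r f = f.
Proof. by move=> sf; apply: isobaric_unique; rewrite sf mulrBl. Qed.

(** Applying s_r to the defining equation changes the sign of both sides, so s_r (pi_r f) solves the
    same equation as pi_r f. *)
Lemma msym_isobaric r f : sw r (isobaric r f) = isobaric r f.
Proof.
apply/esym/isobaric_unique.
have := congr1 (msym (simple_tperm r)) (isobaric_divE r f).
rewrite !(msymM, msymB) msym_lo msym_hi msym_simple_tpermK => e.
by rewrite -[LHS]opprK -mulNr opprB e opprB.
Qed.

Lemma isobaric_idem r f : isobaric r (isobaric r f) = isobaric r f.
Proof. exact/isobaric_fix/msym_isobaric. Qed.

Lemma isobaric_hat0 r : isobaric_hat r 0 = 0.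
Proof. by rewrite /isobaric_hat isobaric0 subrr. Qed.

(** The numerator is homogeneous of degree d + 1, so the degree d component of the quotient already
    solves the defining equation. *)
Lemma isobaric_homog r f d :
  f \is d.-homog for mdeg -> isobaric r f \is d.-homog for mdeg.
Proof.
move=> hf; set q : {mpoly int[n]} := 'X_(lo r) - 'X_(hi r).
have hX i : ('X_i : {mpoly int[n]}) \is 1.-homog for mdeg.
  by rewrite dhomogX; apply/eqP; exact: mdeg1.
have hs : sw r f \is d.-homog for mdeg.
  by rewrite homog_piE -msym_pihomog pihomog_dE.
have hq : q \is 1.-homog for mdeg by apply: rpredB.
suff -> : isobaric r f = pihomog mdeg d (isobaric r f) by apply: pihomogP.
apply/isobaric_unique; rewrite -/q.
set g := isobaric r f; have hqg : q * g \is d.+1.-homog for mdeg.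
  by rewrite isobaric_divE; apply: rpredB; rewrite -add1n; apply: dhomogM.
have hqgh e : q * pihomog mdeg e g \is e.+1.-homog for mdeg.
  by rewrite -add1n; apply: dhomogM hq (pihomogP _ _ _).
rewrite -isobaric_divE -/q -/g -[RHS](pihomog_dE hqg).
(* The bound is large enough for d to occur among the degrees of the decomposition even when [g] has
   smaller size. *)
have [k] : exists k : 'I_(maxn (msize g) d.+1), k == d :> nat.
  by exists (Ordinal (leq_maxr (msize g) d.+1)).
move=> /eqP def_k.
rewrite {2}(@pihomog_partitionE _ _ mdeg (maxn (msize g) d.+1) g) ?leq_maxl //.
rewrite [in RHS]mulr_sumr (big_morph _ (pihomogD mdeg _) (pihomog0 _ _ _)) (bigD1 k) //= def_k big1 ?addr0 => [|i ne_i].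
  by rewrite (pihomog_dE (hqgh d)).
apply: (pihomog_ne0 _ (hqgh i)).
by rewrite eqSS; apply: contra ne_i => /eqP e; apply/eqP/val_inj; rewrite /= def_k.
Qed.

Lemma isobaric_comm r r' f : (r.+1 < r')%N ->
  isobaric r (isobaric r' f) = isobaric r' (isobaric r f).
Proof.
move=> lt_rr'.
have ne : [/\ lo r' != lo r, lo r' != hi r, hi r' != lo r & hi r' != hi r].
  by split; rewrite -val_eqE /=; lia.
have [n1 n2 n3 n4] := ne.
have comm_s g : sw r (sw r' g) = sw r' (sw r g).
  by rewrite -!msymMm (simple_tperm_comm lt_rr').
have sX : sw r' 'X_(lo r) = 'X_(lo r) /\ sw r' 'X_(hi r) = 'X_(hi r).
  by rewrite !msymXU /simple_tperm !tpermD.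
have sX' : sw r 'X_(lo r') = 'X_(lo r') /\ sw r 'X_(hi r') = 'X_(hi r').
  by rewrite !msymXU /simple_tperm !tpermD // eq_sym.
have [[s1 s2] [s3 s4]] := (sX, sX').
have e g : ('X_(lo r') - 'X_(hi r')) * sw r (isobaric r' g)
           = 'X_(lo r') * sw r g - 'X_(hi r') * sw r (sw r' g).
  have := congr1 (msym (simple_tperm r)) (isobaric_divE r' g).
  by rewrite !(msymM, msymB) s3 s4.
have e' : ('X_(lo r) - 'X_(hi r)) * sw r' (isobaric r f)
           = 'X_(lo r) * sw r' f - 'X_(hi r) * sw r (sw r' f).
  have := congr1 (msym (simple_tperm r')) (isobaric_divE r f).
  by rewrite !(msymM, msymB) s1 s2 comm_s.
apply: isobaric_unique; apply: (mulfI (subX_neq0 (lo_neq_hi r'))).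
exact: (isobaric_comm_ring (isobaric_divE r f) (isobaric_divE r' f) (e f) e'
          (isobaric_divE r' (isobaric r f))).
Qed.
Lemma isobaric_braid r r' f : r' = r.+1 :> nat ->
  isobaric r (isobaric r' (isobaric r f))
  = isobaric r' (isobaric r (isobaric r' f)).
Proof.
move=> def_r'; have lo_r' : lo r' = hi r by apply: val_inj.
have n1 := lo_neq_hi r; have n2 := lo_neq_hi r'; rewrite lo_r' in n2.
have n3 : lo r != hi r' by rewrite -val_eqE /= def_r' neq_ltn; lia.
have braid_s g : sw r (sw r' (sw r g)) = sw r' (sw r (sw r' g)).
  by rewrite -!msymMm !mulgA (simple_tperm_braid def_r').
have [sb sc] : sw r' 'X_(hi r) = 'X_(hi r') /\ sw r' 'X_(hi r') = 'X_(hi r).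
  by rewrite -lo_r' msym_lo msym_hi.
have sa : sw r' 'X_(lo r) = 'X_(lo r).
  by rewrite msymXU /simple_tperm lo_r' tpermD // eq_sym.
have sc' : sw r 'X_(hi r') = 'X_(hi r').
  by rewrite msymXU /simple_tperm tpermD // eq_sym.
have E := isobaric_divE r; have E' := isobaric_divE r'; rewrite lo_r' in E'.
have Es g : ('X_(lo r) - 'X_(hi r')) * sw r' (isobaric r g)
            = 'X_(lo r) * sw r' g - 'X_(hi r') * sw r' (sw r g).
  by have := congr1 (msym (simple_tperm r')) (E g); rewrite !(msymM, msymB) sa sb.
have Es' g : ('X_(lo r) - 'X_(hi r')) * sw r (isobaric r' g)
             = 'X_(lo r) * sw r g - 'X_(hi r') * sw r (sw r' g).
  have := congr1 (msym (simple_tperm r)) (E' g).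
  by rewrite !(msymM, msymB) msym_hi sc'.
have Ess g : ('X_(hi r) - 'X_(hi r')) * sw r (sw r' (isobaric r g))
             = 'X_(hi r) * sw r (sw r' g) - 'X_(hi r') * sw r (sw r' (sw r g)).
  have := congr1 (msym (simple_tperm r)) (Es g).
  by rewrite !(msymM, msymB) msym_lo sc'.
have Ess' g : ('X_(lo r) - 'X_(hi r)) * sw r' (sw r (isobaric r' g))
             = 'X_(lo r) * sw r' (sw r g) - 'X_(hi r) * sw r (sw r' (sw r g)).
  have := congr1 (msym (simple_tperm r')) (Es' g).
  by rewrite !(msymM, msymB) sa sc braid_s.
have n4 : ('X_(lo r) - 'X_(hi r)) * ('X_(lo r) - 'X_(hi r'))
          * ('X_(hi r) - 'X_(hi r')) != 0 :> {mpoly int[n]}.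
  by rewrite !mulf_neq0 ?subX_neq0.
apply: (mulfI n4).
(* Since s_r fixes pi_r f, the numerator contains pi_r f itself, as the ring identity requires;
   likewise for r'. *)
have Ei := etrans (Es' _) (congr1 (fun z => _ * z - _) (msym_isobaric r f)).
have Ei' := etrans (Es _) (congr1 (fun z => _ * z - _) (msym_isobaric r' f)).
exact: (isobaric_braid_ring (E f) (Es f) (Ess f) (E' _) Ei (E _)
          (E' f) (Es' f) (Ess' f) (E _) Ei' (E' _)).
Qed.

Lemma isobaric_hat_comm r r' f : (r.+1 < r')%N ->
  isobaric_hat r (isobaric_hat r' f) = isobaric_hat r' (isobaric_hat r f).
Proof.
move=> lt_rr'; rewrite /isobaric_hat (isobaricB r) (isobaricB r').
by rewrite (isobaric_comm f lt_rr'); apply: sub_sub_swap.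
Qed.

Lemma isobaric_hat_braid r r' f : r' = r.+1 :> nat ->
  isobaric_hat r (isobaric_hat r' (isobaric_hat r f))
  = isobaric_hat r' (isobaric_hat r (isobaric_hat r' f)).
Proof.
move=> def_r'; apply: (hat_braid (isobaricB r) (isobaricB r')).
- exact: isobaric_idem.
- exact: isobaric_idem.
exact: isobaric_braid.
Qed.

Lemma isobaric_hat_homog r f d :
  f \is d.-homog for mdeg -> isobaric_hat r f \is d.-homog for mdeg.
Proof. by move=> hf; apply: rpredB => //; apply: isobaric_homog. Qed.

End IsobaricTheory.

(** * Recursions along ascents *)

Section AscentSwaps.
Variable n : nat.
Implicit Types (r : 'I_n.-1) (a b : 'X_{1..n}) (w : seq 'I_n.-1).

Definition mperm (s : 'S_n) a : 'X_{1..n} := [multinom a (s i) | i < n].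
Definition mswap r a := mperm (simple_tperm r) a.

Lemma mpermE s a i : mperm s a i = a (s i).
Proof. by rewrite mnmE. Qed.

Lemma mpermM s t a : mperm s (mperm t a) = mperm (s * t)%g a.
Proof. by apply/mnmP=> i; rewrite !mpermE permM. Qed.

Lemma mperm1 a : mperm 1%g a = a.
Proof. by apply/mnmP=> i; rewrite mpermE perm1. Qed.

Lemma mswap_lo r a : mswap r a (lo r) = a (hi r).
Proof. by rewrite mpermE tpermL. Qed.

Lemma mswap_hi r a : mswap r a (hi r) = a (lo r).
Proof. by rewrite mpermE tpermR. Qed.

Lemma mswap_out r a i : i != lo r -> i != hi r -> mswap r a i = a i.
Proof. by move=> nl nh; rewrite mpermE tpermD // eq_sym. Qed.

Lemma mswapK r : involutive (mswap r).
Proof. by move=> a; rewrite /mswap mpermM tperm2 mperm1. Qed.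

Lemma mswap_comm r r' a : r.+1 < r' ->
  mswap r (mswap r' a) = mswap r' (mswap r a).
Proof. by move=> lt; rewrite /mswap !mpermM (simple_tperm_comm lt). Qed.

Lemma mswap_braid r r' a : r' = r.+1 :> nat ->
  mswap r (mswap r' (mswap r a)) = mswap r' (mswap r (mswap r' a)).
Proof. by move=> e; rewrite /mswap !mpermM (simple_tperm_braid e). Qed.

Lemma mswap_weight r a : a (lo r) < a (hi r) ->
  ascent_weight (mswap r a) < ascent_weight a.
Proof. exact: ascent_weight_lt. Qed.

Section Confluence.
Variables (T : Type) (op : 'I_n.-1 -> T -> T) (base : 'X_{1..n} -> T).
Hypothesis op_comm : forall r r' v, r.+1 < r' -> op r (op r' v) = op r' (op r v).
Hypothesis op_braid : forall r r' v, r' = r.+1 :> nat ->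
  op r (op r' (op r v)) = op r' (op r (op r' v)).

(** The type [T] is arbitrary because four recursions are used: keys, atoms, lengths ([op := S]),
    and the one with constant base, which evaluates words of operators. *)
Definition ascent_rec (F : 'X_{1..n} -> T) := forall a,
  F a = if [pick r | a (lo r) < a (hi r)] is Some r
        then op r (F (mswap r a)) else base a.

Variable F : 'X_{1..n} -> T.
Hypothesis FE : ascent_rec F.

(** Any ascent may be chosen. Two distant ascents can be exchanged in either order; two adjacent
    ones belong to three increasing entries, and the two ways of reversing these agree by the braid
    relation. *)
Lemma ascent_rec_step a r : a (lo r) < a (hi r) -> F a = op r (F (mswap r a)).
Proof.
have [l] := ubnP (ascent_weight a); elim: l a r => // l IHl a r /ltnSE le_al asc_r.
rewrite FE; case: pickP => [r0 asc_r0|/(_ r)]; last by rewrite asc_r.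
have IH b t : ascent_weight b < ascent_weight a -> b (lo t) < b (hi t) ->
    F b = op t (F (mswap t b)) by move=> lt_ba; apply: IHl; apply: leq_trans le_al.
wlog le_r : r r0 asc_r asc_r0 / r <= r0.
  by move=> wl; case: (leqP r r0) => [|/ltnW] le; [|apply: esym]; apply: wl.
have [eq_r|ne_r] := eqVneq r r0; first by rewrite eq_r.
have wr := mswap_weight asc_r; have wr0 := mswap_weight asc_r0.
have {ne_r}lt_r : r < r0 by rewrite ltn_neqAle le_r andbT.
have [lt_r1|le_r1] := ltnP r.+1 r0.
  have asc1 : mswap r a (lo r0) < mswap r a (hi r0).
    by rewrite !mswap_out // -val_eqE /=; lia.
  have asc2 : mswap r0 a (lo r) < mswap r0 a (hi r).
    by rewrite !mswap_out // -val_eqE /=; lia.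
  by rewrite (IH _ r0 wr) // (IH _ r wr0) // (op_comm _ lt_r1) (mswap_comm _ lt_r1).
have def_r0 : r0 = r.+1 :> nat by lia.
have lo_r0 : lo r0 = hi r by apply: val_inj.
have [out1l out1h] : hi r0 != lo r /\ hi r0 != hi r by rewrite -!val_eqE /=; lia.
have [out2l out2h] : lo r != lo r0 /\ lo r != hi r0 by rewrite -!val_eqE /=; lia.
have asc1 : mswap r a (lo r0) < mswap r a (hi r0).
  rewrite lo_r0 mswap_hi mswap_out //.
  by apply: ltn_trans asc_r _; rewrite -lo_r0.
have asc1' : mswap r0 (mswap r a) (lo r) < mswap r0 (mswap r a) (hi r).
  by rewrite mswap_out // mswap_lo -lo_r0 mswap_lo mswap_out.
have asc2 : mswap r0 a (lo r) < mswap r0 a (hi r).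
  rewrite -lo_r0 mswap_lo mswap_out //.
  by apply: ltn_trans asc_r _; rewrite -lo_r0.
have asc2' : mswap r (mswap r0 a) (lo r0) < mswap r (mswap r0 a) (hi r0).
  by rewrite lo_r0 mswap_hi 2?mswap_out // mswap_hi lo_r0.
rewrite (IH _ r0 wr) // (IH _ r _ asc1') ?(ltn_trans (mswap_weight asc1)) //.
rewrite (IH _ r wr0) // (IH _ r0 _ asc2') ?(ltn_trans (mswap_weight asc2)) //.
by rewrite (op_braid _ def_r0) (mswap_braid _ def_r0).
Qed.

(** The operator is pushed through the first step of the recursion. If the indices are adjacent, two
    steps are taken and the braid relation moves the equal pair to the other index. For keys [c] is
    the identity, for atoms it is zero. *)
Lemma ascent_rec_eq (c : T -> T) :
    (forall r v, op r (c v) = c (op r v)) ->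
    (forall a r, a (lo r) = a (hi r) -> op r (base a) = c (base a)) ->
  forall a r, a (lo r) = a (hi r) -> op r (F a) = c (F a).
Proof.
move=> op_c base_c a; have [l] := ubnP (ascent_weight a).
elim: l a => // l IHl a /ltnSE le_al r eq_r.
rewrite {1 2}FE; case: pickP => [r0 asc_r0|_]; last exact: base_c.
have IH b t : ascent_weight b < ascent_weight a -> b (lo t) = b (hi t) ->
    op t (F b) = c (F b) by move=> lt_ba; apply: IHl; apply: leq_trans le_al.
have wr0 := mswap_weight asc_r0.
have [far|near] : (r.+1 < r0 \/ r0.+1 < r) \/ (r0 = r.+1 :> nat \/ r = r0.+1 :> nat).
  have ne_r : r != r0 :> nat.
    by apply: contraTneq asc_r0 => /val_inj <-; rewrite eq_r ltnn.
  lia.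
  have eq1 : mswap r0 a (lo r) = mswap r0 a (hi r).
    by rewrite !mswap_out // -val_eqE /=; lia.
  case: far => far; first by rewrite (op_comm _ far) IH // op_c.
  by rewrite -(op_comm _ far) IH // op_c.
case: near => [def_r0|def_r].
  have lo_r0 : lo r0 = hi r by apply: val_inj.
  have [out1l out1h] : hi r0 != lo r /\ hi r0 != hi r by rewrite -!val_eqE /=; lia.
  have [out2l out2h] : lo r != lo r0 /\ lo r != hi r0 by rewrite -!val_eqE /=; lia.
  have asc2 : mswap r0 a (lo r) < mswap r0 a (hi r).
    by rewrite -lo_r0 mswap_lo mswap_out // eq_r -lo_r0.
  rewrite (ascent_rec_step asc2) (op_braid _ def_r0) IH ?op_c //.
    exact: ltn_trans (mswap_weight asc2) wr0.
  by rewrite lo_r0 mswap_hi 2?mswap_out // mswap_hi lo_r0.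
have hi_r0 : hi r0 = lo r by apply: val_inj.
have [out1l out1h] : lo r0 != lo r /\ lo r0 != hi r by rewrite -!val_eqE /=; lia.
have [out2l out2h] : hi r != lo r0 /\ hi r != hi r0 by rewrite -!val_eqE /=; lia.
have asc2 : mswap r0 a (lo r) < mswap r0 a (hi r).
  by rewrite -hi_r0 mswap_hi mswap_out // -eq_r -hi_r0.
rewrite (ascent_rec_step asc2) -(op_braid _ def_r) IH ?op_c //.
  exact: ltn_trans (mswap_weight asc2) wr0.
rewrite hi_r0 mswap_lo (mswap_out _ out1l out1h).
by rewrite (mswap_out _ out2l out2h) mswap_lo hi_r0.
Qed.

Fixpoint ascent_fix (fuel : nat) a : T :=
  if fuel is fuel'.+1 then
    if [pick r | a (lo r) < a (hi r)] is Some r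
    then op r (ascent_fix fuel' (mswap r a)) else base a
  else base a.

Lemma ascent_fix_fuel l l' a : ascent_weight a <= l -> ascent_weight a <= l' ->
  ascent_fix l a = ascent_fix l' a.
Proof.
elim: l l' a => [|l IHl] [|l'] a //=.
- by rewrite leqn0 => /eqP a0 _; case: pickP => // r /mswap_weight; rewrite a0.
- by rewrite leqn0 => _ /eqP a0; case: pickP => // r /mswap_weight; rewrite a0.
move=> le_al le_al'; case: pickP => // r /mswap_weight lt_a.
by congr (op r _); apply: IHl; rewrite -ltnS (leq_trans lt_a).
Qed.

Lemma ascent_rec_exists : exists G, ascent_rec G.
Proof.
exists (fun a => ascent_fix (ascent_weight a) a) => a.
rewrite (@ascent_fix_fuel _ (ascent_weight a).+1) //=.
by case: pickP => // r /mswap_weight/ltnW le_a; congr (op r _); apply: ascent_fix_fuel.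
Qed.

End Confluence.

(** * Words acting on exponents, and reduced words *)

Definition descent_step r a : option 'X_{1..n} :=
  if a (hi r) < a (lo r) then Some (mswap r a) else None.

(** The rightmost letter acts first. A result [Some b] certifies that every letter exchanges a
    strict descent, so that [w] read from the left is a path of the ascent recursions from [b] down
    to [a]. *)
Definition run w a : option 'X_{1..n} :=
  foldr (fun r => obind (descent_step r)) (Some a) w.

Lemma run_cons r w a b : run (r :: w) a = Some b ->
  [/\ run w a = Some (mswap r b), b (lo r) < b (hi r)
    & b = mswap r (mswap r b)].
Proof.
rewrite /run /=; case: foldr => //= c; rewrite /descent_step.
by case: ifP => // lt_c [<-]; rewrite !mswapK mswap_lo mswap_hi.
Qed.

Lemma word_perm_cons r w : word_perm (r :: w) = (word_perm w * simple_tperm r)%g.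
Proof. by rewrite /word_perm rev_cons -cats1 big_cat big_seq1. Qed.

Lemma mperm_word_cons r w a :
  mperm (word_perm (r :: w))^-1%g a = mswap r (mperm (word_perm w)^-1%g a).
Proof. by rewrite word_perm_cons invMg tpermV /mswap mpermM. Qed.

Lemma run_mperm w a b : run w a = Some b -> b = mperm (word_perm w)^-1%g a.
Proof.
elim: w b => [|r w IHw] b; first by case=> <-; rewrite /word_perm big_nil invg1 mperm1.
by case/run_cons => /IHw def_b _ ->; rewrite mperm_word_cons def_b.
Qed.

Lemma run_foldr T (op : 'I_n.-1 -> T -> T) base F w a b :
    (forall r r' v, r.+1 < r' -> op r (op r' v) = op r' (op r v)) ->
    (forall r r' v, r' = r.+1 :> nat ->
       op r (op r' (op r v)) = op r' (op r (op r' v))) ->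
    ascent_rec op base F ->
  run w a = Some b -> F b = foldr op (F a) w.
Proof.
move=> opC opB FE; elim: w b => [|r w IHw] b; first by case=> <-.
by case/run_cons => /IHw def_b asc_b _; rewrite (ascent_rec_step opC opB FE asc_b) def_b.
Qed.

(** The exponent (n, ..., 1) has no ascent, and its entries are distinct, so that its rearrangements
    correspond to permutations. *)
Definition staircase_mnm : 'X_{1..n} := [multinom n - i | i < n].
Local Notation delta := staircase_mnm.

Lemma staircase_mnm_inj : injective delta.
Proof.
move=> i j; rewrite !mnmE => e; apply/val_inj => /=.
by have := ltn_ord i; have := ltn_ord j; lia.
Qed.

Lemma ascent_rec_staircase T (op : 'I_n.-1 -> T -> T) base F :
  ascent_rec op base F -> F delta = base delta.
Proof. by move->; case: pickP => // r; rewrite !mnmE /=; lia. Qed.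

(** Undoing an ascent of the rearranged staircase lowers its weight, which yields the word letter by
    letter; without ascents the permutation is trivial. *)
Lemma run_exists (s : 'S_n) :
  exists2 w, word_perm w = s & run w delta = Some (mperm s^-1%g delta).
Proof.
have [l] := ubnP (ascent_weight (mperm s^-1%g delta)).
elim: l s => // l IHl s /ltnSE le_sl.
have [/existsP[r asc_r]|/existsPn no_asc] :=
  boolP [exists r, mperm s^-1%g delta (lo r) < mperm s^-1%g delta (hi r)].
  have def_m : mperm (s * simple_tperm r)^-1%g delta = mswap r (mperm s^-1%g delta).
    by rewrite invMg tpermV /mswap mpermM.
  have [|w def_s run_w] := IHl (s * simple_tperm r)%g.
    by rewrite def_m; apply: leq_trans le_sl; apply: mswap_weight.
  exists (r :: w); first by rewrite word_perm_cons def_s -mulgA tperm2 mulg1.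
  rewrite /run /= -/(run w delta) run_w /= def_m /descent_step.
  by rewrite mswap_lo mswap_hi asc_r mswapK.
(* The entries are n - s^-1 i, so the absence of ascents means that s^-1 is increasing. *)
have incr (i j : 'I_n) : j = i.+1 :> nat -> (s^-1%g i < s^-1%g j)%N.
  move=> def_j; have lt_i : i < n.-1 by have := ltn_ord j; lia.
  have := no_asc (Ordinal lt_i); rewrite !mpermE !mnmE /=.
  have -> : lo (Ordinal lt_i) = i by apply: val_inj.
  have -> : hi (Ordinal lt_i) = j by apply: val_inj; rewrite /= def_j.
  have ne_ij : s^-1%g i != s^-1%g j :> nat.
    by apply/eqP => /val_inj/perm_inj e; move: def_j; rewrite e; lia.
  by have := ltn_ord (s^-1%g i); have := ltn_ord (s^-1%g j); lia.
(* An increasing permutation is bounded below by the identity, counting from the first position, and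
   above by it, counting from the last. *)
have lb d (i : 'I_n) : i = d :> nat -> i <= s^-1%g i.
  elim: d i => [|d IHd] i def_i; first by rewrite def_i.
  have lt_d : d < n by have := ltn_ord i; lia.
  have := IHd (Ordinal lt_d) erefl; have := incr (Ordinal lt_d) i def_i.
  by rewrite /=; lia.
have ub d (i : 'I_n) : i + d.+1 = n -> s^-1%g i <= i.
  elim: d i => [|d IHd] i def_i; first by have := ltn_ord (s^-1%g i); lia.
  have lt_i : i.+1 < n by lia.
  have := incr i (Ordinal lt_i) erefl; have := IHd (Ordinal lt_i).
  by rewrite /=; lia.
have s1 : s = 1%g.
  apply: invg_inj; rewrite invg1; apply/permP => i; rewrite perm1; apply: val_inj.
  apply/eqP; rewrite eqn_leq (lb i) // andbT (ub (n - i.+1)) //.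
  by have := ltn_ord i; lia.
exists [::]; first by rewrite /word_perm big_nil s1.
by rewrite s1 invg1 mperm1.
Qed.

(** Each letter raises [L] by one at a descent and lowers it by one at an ascent; equal entries do
    not occur. Reaching the value [size w] forces every letter to act at a descent. *)
Lemma run_length_le (L : 'X_{1..n} -> nat) w :
    ascent_rec (fun _ => S) (fun _ => 0) L ->
  L (mperm (word_perm w)^-1%g delta) <= size w
  /\ (L (mperm (word_perm w)^-1%g delta) = size w -> run w delta).
Proof.
move=> LE; have step := @ascent_rec_step nat (fun _ => S) _ (fun _ _ _ _ => erefl)
  (fun _ _ _ _ => erefl) _ LE.
elim: w => [|r w [IHle IHeq]].
  by rewrite /word_perm big_nil invg1 mperm1 (ascent_rec_staircase LE).
rewrite mperm_word_cons; set b := mperm _ _ in IHle IHeq *.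
have [asc|desc|eq_b] := ltngtP (b (lo r)) (b (hi r)).
- by have := step _ _ asc; rewrite /=; split; lia.
- have := step (mswap r b) r; rewrite mswap_lo mswap_hi mswapK => /(_ desc) e.
  rewrite e /=; split=> [|[/IHeq]]; first exact: IHle.
  rewrite /run /= -/(run w delta); case run_w: (run w delta) => [c|//] _ /=.
  by rewrite (run_mperm run_w) -/b /descent_step desc.
move: eq_b; rewrite !mpermE => /staircase_mnm_inj/perm_inj/eqP.
by rewrite (negPf (lo_neq_hi r)).
Qed.

(* The length of a permutation is the value at [mperm s^-1 staircase_mnm] of the
   ascent recursion for [op := S], so that confluence also yields that reduced
   words are exactly those along which every exchange creates an ascent. *)
Lemma isobaric_perm_run w f : run w delta ->
  isobaric_perm (word_perm w) f = foldr (@isobaric n) f w.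
Proof.
rewrite /isobaric_perm; case run_w: (run w delta) => [b|//] _.
set w0 := xchoose _.
have /reduced_wordP[def_w0 min_w0] := xchooseP (reduced_word_exists (word_perm w)).
rewrite -/w0 in def_w0 min_w0.
have [L LE] := @ascent_rec_exists nat (fun _ => S) (fun _ => 0).
have L0 := ascent_rec_staircase LE.
have [w1 def_w1 run_w1] := run_exists (word_perm w).
have len_w1 := @run_foldr nat (fun _ => S) _ _ _ _ _ (fun _ _ _ _ => erefl)
  (fun _ _ _ _ => erefl) LE run_w1.
have {}len_w1 : L (mperm (word_perm w)^-1%g delta) = size w1.
  by rewrite len_w1 L0; elim: (w1) => //= r v ->.
have [le_L eq_L] := run_length_le w0 LE.
have : run w0 delta.
  by apply: eq_L; apply/eqP; rewrite eqn_leq le_L def_w0 len_w1 min_w0.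
case run_w0: (run w0 delta) => [b0|//] _.
(* With constant base, [F] is [f] at the staircase, and both words compute the value of [F] at the
   same rearrangement. *)
have [F FE] := ascent_rec_exists (@isobaric n) (fun=> f).
have F0 := ascent_rec_staircase FE.
have comm := @isobaric_comm n; have braid := @isobaric_braid n.
have := run_foldr comm braid FE run_w; have := run_foldr comm braid FE run_w0.
by rewrite F0 (run_mperm run_w) (run_mperm run_w0) def_w0 => -> ->.
Qed.

(** * Divided differences of key polynomials and atoms *)

Local Open Scope ring_scope.

Lemma key_ascent_rec : ascent_rec (@isobaric n) (fun a => 'X_[a]) (@key n).
Proof. exact: keyE. Qed.

Lemma atom_ascent_rec : ascent_rec (@isobaric_hat n) (fun a => 'X_[a]) (@atom n).
Proof. exact: atomE. Qed.

Lemma isobaric_monomial a r : a (lo r) = a (hi r) ->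
  isobaric r 'X_[a] = 'X_[a].
Proof.
move=> eq_a; apply: isobaric_fix; rewrite msymX; congr 'X_[_].
apply/mnmP => i; rewrite mnmE tpermV /simple_tperm.
by case: tpermP => // ->.
Qed.

(** A descent reverses a step of the recursion, an ascent gives pi_r pi_r = pi_r, and equal entries
    make the key polynomial symmetric. *)
Lemma isobaric_key a r : isobaric r (key a)
  = key (if (a (hi r) < a (lo r))%N then mswap r a else a).
Proof.
have comm := @isobaric_comm n; have braid := @isobaric_braid n.
have step := ascent_rec_step comm braid key_ascent_rec.
have [desc|asc|eq_a] := ltngtP (a (hi r)) (a (lo r)).
- by rewrite (step (mswap r a) r) ?mswapK // mswap_lo mswap_hi.
- by rewrite (step _ _ asc) isobaric_idem.
apply: (ascent_rec_eq comm braid key_ascent_rec (c := id)) => // b t.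
exact: isobaric_monomial.
Qed.

Lemma isobaric_hat_atom_desc a r : (a (hi r) < a (lo r))%N ->
  isobaric_hat r (atom a) = atom (mswap r a).
Proof.
move=> desc; have comm := @isobaric_hat_comm n; have braid := @isobaric_hat_braid n.
by rewrite (ascent_rec_step comm braid atom_ascent_rec (a := mswap r a) (r := r))
  ?mswapK // mswap_lo mswap_hi.
Qed.

(** The case of zero [c] in [ascent_rec_eq]: hat pi_r kills monomials that are symmetric under
    s_r. *)
Lemma isobaric_hat_atom_eq a r : a (lo r) = a (hi r) ->
  isobaric_hat r (atom a) = 0.
Proof.
have comm := @isobaric_hat_comm n; have braid := @isobaric_hat_braid n.
apply: (ascent_rec_eq comm braid atom_ascent_rec (c := fun=> 0)) => [t v|b t eq_b].
  exact: isobaric_hat0.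
by rewrite /isobaric_hat isobaric_monomial // subrr.
Qed.

Lemma ascent_rec_homog (op : 'I_n.-1 -> {mpoly int[n]} -> {mpoly int[n]}) F a :
    (forall r f d, f \is d.-homog for mdeg -> op r f \is d.-homog for mdeg) ->
    ascent_rec op (fun a => 'X_[a]) F ->
  F a \is (mdeg a).-homog for mdeg.
Proof.
move=> op_homog FE; have [l] := ubnP (ascent_weight a).
elim: l a => // l IHl a /ltnSE le_al; rewrite FE.
case: pickP => [r asc_r|_]; last by rewrite dhomogX; apply/eqP.
apply: op_homog; have -> : mdeg a = mdeg (mswap r a).
  rewrite !mdegE (reindex_inj (@perm_inj _ (simple_tperm r))) /=.
  by apply: eq_bigr => i _; rewrite mpermE.
by apply: IHl; apply: leq_trans le_al; apply: mswap_weight.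
Qed.

(* Exponents supported on an initial segment have no ascent at its end, so
   adding one to all of these entries commutes with the recursion. *)
Lemma ascent_rec_shift (op : 'I_n.-1 -> {mpoly int[n]} -> {mpoly int[n]}) F
    (e a : 'X_{1..n}) k :
    (forall r f g, msym (simple_tperm r) g = g -> op r (g * f) = g * op r f) ->
    ascent_rec op (fun a => 'X_[a]) F ->
    (forall i : 'I_n, e i = (i < k)%N) ->
    (forall i : 'I_n, (k <= i)%N -> a i = 0%N) ->
  F (a + e)%MM = 'X_[e] * F a.
Proof.
move=> opM FE def_e; have [l] := ubnP (ascent_weight a).
elim: l a => // l IHl a /ltnSE le_al supp_a; rewrite !FE.
have asc_eq : (fun r => (a + e)%MM (lo r) < (a + e)%MM (hi r))%N
              =1 (fun r => a (lo r) < a (hi r))%N.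
  move=> r; rewrite !mnmDE !def_e /=.
  have [lt|le] := ltnP r.+1 k; first by rewrite (ltnW lt) /= ltn_add2r.
  by rewrite (supp_a (hi r)) //; case: (r < k)%N; rewrite ?addn0 ?addn1 //; lia.
rewrite (eq_pick asc_eq); case: pickP => [r asc_r|_]; last by rewrite mpolyXD mulrC.
have lt_k : (r.+1 < k)%N.
  by rewrite ltnNge; apply/negP => le_k; move: asc_r; rewrite (supp_a (hi r)).
have swap_e : mswap r e = e.
  apply/mnmP => i; rewrite mpermE !def_e /simple_tperm.
  by case: tpermP => // ->; rewrite /=; lia.
have -> : mswap r (a + e)%MM = (mswap r a + e)%MM.
  by rewrite -{2}swap_e; apply/mnmP => i; rewrite !(mpermE, mnmDE).
rewrite IHl; last first.
- move=> i le_i; rewrite mswap_out ?supp_a //; rewrite -val_eqE /=; lia.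
- by apply: leq_trans le_al; apply: mswap_weight.
rewrite opM // msymX; congr 'X_[_]; rewrite -{2}swap_e.
by apply/mnmP => i; rewrite mpermE mnmE tpermV.
Qed.

End AscentSwaps.

(** * Complete homogeneous polynomials *)

Section CompleteHomogeneous.
Local Open Scope ring_scope.

(** The coefficients of t^k times the series with coefficients [f]. *)
Definition shift_seq (R : nmodType) k (f : nat -> R) d : R :=
  if (k <= d)%N then f (d - k)%N else 0.

Lemma shift_seq0 (R : nmodType) (f : nat -> R) d : shift_seq 0 f d = f d.
Proof. by rewrite /shift_seq subn0. Qed.

Lemma shift_seqD (R : nmodType) k l (f : nat -> R) d :
  shift_seq k (shift_seq l f) d = shift_seq (k + l) f d.
Proof.
rewrite /shift_seq; case: (leqP k d) => le; last by case: leqP => //; lia.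
by rewrite (_ : (l <= d - k)%N = (k + l <= d)%N) ?subnDA //; lia.
Qed.

Lemma eq_shift_seq (R : nmodType) k (f g : nat -> R) d :
  (forall e, (e <= d)%N -> f e = g e) -> shift_seq k f d = shift_seq k g d.
Proof. by move=> fg; rewrite /shift_seq; case: leqP => // _; rewrite fg ?leq_subr. Qed.

Variable R : comNzRingType.
Implicit Types (C : seq R) (a b c : R).

(** The coefficient of t^d in the product of 1/(1 - c t) over the entries c of [C]. *)
Fixpoint hsym C d : R :=
  if C is c :: C' then \sum_(i < d.+1) c ^+ i * hsym C' (d - i)%N else (d == 0%N)%:R.

Lemma hsym_cons c C d : hsym (c :: C) d = hsym C d + c * shift_seq 1 (hsym (c :: C)) d.
Proof.
case: d => [|d] /=; first by rewrite big_ord1 /shift_seq expr0 mul1r mulr0 addr0.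
rewrite big_ord_recl expr0 mul1r subn0 /shift_seq /= subn1 /= mulr_sumr.
by congr (_ + _); apply: eq_bigr => i _; rewrite mulrA -exprS subSS.
Qed.

(** This is (1 - a t)(1 - b t) H = hsym C in coefficients. It is symmetric in a and b and determines
    H degree by degree, whence [hsym_swap]. *)
Lemma hsym_swap_rec a b C d (H := hsym (a :: b :: C)) :
  H d = hsym C d + (a + b) * shift_seq 1 H d - a * b * shift_seq 2 H d.
Proof.
have Hb e : hsym (b :: C) e = H e - a * shift_seq 1 H e 
  by rewrite [H e]hsym_cons -/H; ring.
rewrite [LHS]hsym_cons -/H hsym_cons.
have -> : shift_seq 1 (hsym (b :: C)) d = shift_seq 1 H d - a * shift_seq 2 H d.
  rewrite -(shift_seqD 1 1) /shift_seq; case: ifP => _; last by rewrite mulr0 subrr.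
  by rewrite Hb.
by ring.
Qed.

Lemma hsym_swap a b C d : hsym (a :: b :: C) d = hsym (b :: a :: C) d.
Proof.
have [l] := ubnP d; elim: l d => // l IHl d /ltnSE le_dl.
rewrite !hsym_swap_rec (addrC b) (mulrC b).
have sh k : (0 < k)%N ->
    shift_seq k (hsym (a :: b :: C)) d = shift_seq k (hsym (b :: a :: C)) d.
  by move=> k0; rewrite /shift_seq; case: leqP => // le_kd; apply: IHl; lia.
by rewrite !sh.
Qed.

Lemma eq_hsym_cons c C C' : hsym C =1 hsym C' -> hsym (c :: C) =1 hsym (c :: C').
Proof. by move=> eqC d /=; apply: eq_bigr => i _; rewrite eqC. Qed.

Lemma hsym_perm C C' : perm_eq C C' -> hsym C =1 hsym C'.
Proof.
elim: C C' => [|c C IHC] C' pC.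
  by move: pC; rewrite perm_sym => /perm_nilP ->.
have c_in : c \in C' by rewrite -(perm_mem pC) mem_head.
have rem_c : hsym (c :: rem c C') =1 hsym C'.
  elim: C' c_in {pC} => // b B IHB; rewrite inE eq_sym [rem _ _]/=.
  have [-> //|_ c_in] := eqVneq b c => d.
  by rewrite hsym_swap; apply: eq_hsym_cons; apply: IHB.
move=> d; rewrite -rem_c; apply: eq_hsym_cons; apply: IHC.
by rewrite -(perm_cons c) (perm_trans pC) // perm_to_rem.
Qed.

(** In generating series this is a (1 - u b t) - b (1 - u a t) = a - b, divided by both factors and
    multiplied by the series of [C]. *)
Lemma isobaric_hsym_ring u a b C d (H := hsym (u * a :: u * b :: C)) :
  (a - b) * H d = a * hsym (u * a :: C) d - b * hsym (u * b :: C) d.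
Proof.
have -> : hsym (u * b :: C) d = H d - u * a * shift_seq 1 H d.
  by rewrite [H d]hsym_cons -/H; ring.
have -> : hsym (u * a :: C) d = H d - u * b * shift_seq 1 H d.
  rewrite [H d]hsym_swap hsym_cons -addrA [X in _ + X](_ : _ = 0) ?addr0 //.
  apply/eqP; rewrite subr_eq0; apply/eqP; congr (_ * _).
  by apply: eq_shift_seq => e _; rewrite hsym_swap.
by ring.
Qed.

End CompleteHomogeneous.

Lemma rmorph_hsym (R S : comNzRingType) (f : {rmorphism R -> S}) C d :
  f (hsym C d) = hsym (map f C) d.
Proof.
elim: C d => [|c C IHC] d /=; first by rewrite rmorph_nat.
by rewrite rmorph_sum; apply: eq_bigr => i _; rewrite rmorphM rmorphXn IHC.
Qed.

(** * Operators indexed by natural numbers *)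

Section NatIndexedOperators.
Local Open Scope ring_scope.
Variable N : nat.
Implicit Types (j : nat) (f g : {mpoly int[N]}).

Fact isob_lock : unit. Proof. exact: tt. Qed.
(** Natural indices let the same words act on n and on n + n variables. Out of range the operator is
    the identity; the lock keeps it folded. *)
Definition isob j := locked_with isob_lock (fun f =>
  if insub j is Some r then isobaric (r : 'I_N.-1) f else f).
Definition ihat j f := isob j f - f.
Definition swp j f : {mpoly int[N]} :=
  if insub j is Some r then msym (simple_tperm (r : 'I_N.-1)) f else f.
Definition varX i : {mpoly int[N]} := if insub i is Some r then 'X_(r : 'I_N) else 0.

Lemma isob_ord (r : 'I_N.-1) f : isob r f = isobaric r f.
Proof. by rewrite /isob unlock valK. Qed.

Lemma ihat_ord (r : 'I_N.-1) f : ihat r f = isobaric_hat r f.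
Proof. by rewrite /ihat isob_ord. Qed.

Lemma swp_ord (r : 'I_N.-1) f : swp r f = msym (simple_tperm r) f.
Proof. by rewrite /swp valK. Qed.

Lemma varX_ord (i : 'I_N) : varX i = 'X_i.
Proof. by rewrite /varX valK. Qed.

Lemma isob_out j f : (N <= j.+1)%N -> isob j f = f.
Proof. by move=> le; rewrite /isob unlock insubF //; lia. Qed.

Lemma swp_out j f : (N <= j.+1)%N -> swp j f = f.
Proof. by move=> le; rewrite /swp insubF //; lia. Qed.

Lemma index_ordP j : (exists r : 'I_N.-1, j = r) \/ (N <= j.+1)%N.
Proof.
have [lt|le] := ltnP j N.-1; last by right; lia.
by left; exists (Ordinal lt).
Qed.

Lemma isobD j : {morph isob j : f g / f + g}.
Proof.
move=> f g; have [[r ->]|out] := index_ordP j; last by rewrite !isob_out.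
by rewrite !isob_ord; apply: isobaricD.
Qed.

Lemma isob0 j : isob j 0 = 0.
Proof.
have [[r ->]|out] := index_ordP j; last by rewrite !isob_out.
by rewrite isob_ord isobaric0.
Qed.

Lemma isob_sum j I (s : seq I) (P : pred I) (F : I -> {mpoly int[N]}) :
  isob j (\sum_(i <- s | P i) F i) = \sum_(i <- s | P i) isob j (F i).
Proof. exact: (big_morph _ (isobD j) (isob0 j)). Qed.

Lemma isobM j f g : swp j g = g -> isob j (g * f) = g * isob j f.
Proof.
have [[r ->]|out] := index_ordP j; last by rewrite !isob_out.
by rewrite swp_ord !isob_ord; apply: isobaricM.
Qed.

Lemma ihat0 j : ihat j 0 = 0.
Proof. by rewrite /ihat isob0 subrr. Qed.

Lemma ihat_sum j I (s : seq I) (P : pred I) (F : I -> {mpoly int[N]}) :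
  ihat j (\sum_(i <- s | P i) F i) = \sum_(i <- s | P i) ihat j (F i).
Proof. by rewrite /ihat isob_sum sumrB. Qed.

Lemma ihatM j f g : swp j g = g -> ihat j (g * f) = g * ihat j f.
Proof. by move=> sg; rewrite /ihat isobM // mulrBr. Qed.

Lemma swpM j f g : swp j (f * g) = swp j f * swp j g.
Proof.
have [[r ->]|out] := index_ordP j; last by rewrite !swp_out.
by rewrite !swp_ord msymM.
Qed.

Definition swap_nat j i := if i == j then j.+1 else if i == j.+1 then j else i.

Lemma swap_natK j : involutive (swap_nat j).
Proof. by rewrite /swap_nat => i; do !case: eqP; lia. Qed.

Lemma swp_varX j i : (j.+1 < N)%N -> swp j (varX i) = varX (swap_nat j i).
Proof.
move=> lt_j; have lt_r : (j < N.-1)%N by lia.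
rewrite -[j]/(val (Ordinal lt_r)) swp_ord.
have [lt_i|le_i] := ltnP i N; last first.
  have -> : swap_nat (Ordinal lt_r) i = i.
    by rewrite /swap_nat; do 2?[case: eqP => //=]; lia.
  by rewrite /varX insubF ?msym0 // ltnNge le_i.
rewrite -[i in LHS]/(val (Ordinal lt_i)) varX_ord msymXU /simple_tperm /swap_nat /=.
case: tpermP => [[->]|[->]|/eqP ne /eqP ne'].
- by rewrite eqxx -[j.+1]/(val (hi (Ordinal lt_r))) varX_ord.
- rewrite eqxx ifN; last by rewrite neq_ltn ltnSn orbT.
  by rewrite -[j]/(val (lo (Ordinal lt_r))) varX_ord.
rewrite -!val_eqE /= in ne ne'; rewrite (negPf ne) (negPf ne').
by rewrite -[i in RHS]/(val (Ordinal lt_i)) varX_ord.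
Qed.

Lemma swp_hsym j C d : swp j (hsym C d) = hsym (map (swp j) C) d.
Proof.
have [[r ->]|out] := index_ordP j; last first.
  by rewrite swp_out // (eq_map (g := id)) ?map_id // => f; rewrite swp_out.
rewrite swp_ord; have := rmorph_hsym (msym (simple_tperm r)) C d.
move=> ->; rewrite (eq_map (g := msym (simple_tperm r))) //.
by move=> f; rewrite swp_ord.
Qed.

(** The exchange permutes [C], so the series of [C] is invariant and pi_j only acts on the factor of
    [u * varX N j]. *)
Lemma isob_hsym j u C d : (j.+1 < N)%N -> swp j u = u ->
    perm_eq (map (swp j) C) C ->
  isob j (hsym (u * varX j :: C) d) = hsym (u * varX j :: u * varX j.+1 :: C) d.
Proof.
move=> lt_j su sC; have := swp_hsym j (u * varX j :: C) d.
rewrite map_cons swpM su swp_varX // {1}/swap_nat eqxx => sH.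
have {sH} : swp j (hsym (u * varX j :: C) d) = hsym (u * varX j.+1 :: C) d.
  by rewrite sH; apply: hsym_perm; rewrite perm_cons.
have lt_r : (j < N.-1)%N by lia.
rewrite -[j]/(val (Ordinal lt_r)) swp_ord isob_ord => sH.
apply: isobaric_unique; rewrite sH -!varX_ord.
exact: isobaric_hsym_ring.
Qed.

End NatIndexedOperators.

(** * Cauchy kernels of shapes *)

Section Kernels.
Local Open Scope ring_scope.
Variable n : nat.
Local Notation R := {mpoly int[n + n]}.
Implicit Types (P Q : pred (nat * nat)) (c : nat * nat) (i j d : nat).

Definition grid : seq (nat * nat) := [seq (i, j) | i <- iota 0 n, j <- iota 0 n].

(* Cells are 0-based: [cell (i, j)] is x_(i+1) * y_(j+1). *)
Definition cell c : R := varX (n + n) c.1 * varX (n + n) (n + c.2).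
Definition kern P : nat -> R := hsym [seq cell c | c <- grid & P c].

Lemma mem_grid c : (c \in grid) = (c.1 < n)%N && (c.2 < n)%N.
Proof.
case: c => i j; rewrite /grid; apply/allpairsP/andP => /= [[[i' j'] /=]|[lt_i lt_j]].
  by rewrite !mem_iota => -[? ? [-> ->]].
by exists (i, j); rewrite !mem_iota.
Qed.

Lemma grid_uniq : uniq grid.
Proof. by apply: allpairs_uniq; rewrite ?iota_uniq // => -[? ?] [? ?] _ _. Qed.

Lemma eq_kern P Q : {in grid, P =1 Q} -> kern P =1 kern Q.
Proof. by move=> eqPQ d; rewrite /kern (eq_in_filter eqPQ). Qed.

Lemma perm_cells_add P c : c \in grid -> ~~ P c ->
  perm_eq [seq c' <- grid | predU1 c P c'] (c :: [seq c' <- grid | P c']).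
Proof.
move=> c_in nPc; apply: uniq_perm => [||c' /=].
- exact/filter_uniq/grid_uniq.
- by rewrite /= mem_filter (negPf nPc) filter_uniq ?grid_uniq.
rewrite inE !mem_filter /=; have [-> /=|_ //] := eqVneq c' c; exact: c_in.
Qed.

Lemma kern_add P c d : c \in grid -> ~~ P c ->
  kern (predU1 c P) d = kern P d + cell c * shift_seq 1 (kern (predU1 c P)) d.
Proof.
move=> c_in nPc; have pc := perm_map cell (perm_cells_add c_in nPc).
rewrite /kern (hsym_perm pc) map_cons hsym_cons; congr (_ + _ * _).
by apply: eq_shift_seq => e _; rewrite -(hsym_perm pc).
Qed.

(** Common form of the x and y cases: [s] is the action of the transposition on cells, and [u] is
    the variable shared by [c] and [s c]. *)
Lemma isob_kern q u (s : nat * nat -> nat * nat) P c d :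
    (q.+1 < n + n)%N -> swp q u = u ->
    cell c = u * varX (n + n) q -> cell (s c) = u * varX (n + n) q.+1 ->
    involutive s -> {in grid, forall b, swp q (cell b) = cell (s b) /\ s b \in grid} ->
    c \in grid -> P c -> ~~ P (s c) ->
    {in grid, forall b, b != c -> b != s c -> P (s b) = P b} ->
  isob q (kern P d) = kern (predU1 (s c) P) d.
Proof.
move=> lt_q su def_c def_sc sK s_grid c_in Pc nPsc P_s.
(* Without [c] the shape is stable under [s], as [isob_hsym] requires. *)
pose Q : pred (nat * nat) := fun b => P b && (b != c).
have nQc : ~~ Q c by rewrite /Q eqxx andbF.
have kQ : kern P =1 hsym (u * varX (n + n) q :: [seq cell b | b <- grid & Q b]).
  have eqP : {in grid, P =1 predU1 c Q}.
    by move=> b _; rewrite /= /Q; have [->|_] := eqVneq b c; rewrite ?Pc ?andbT.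
  move=> e; rewrite (eq_kern eqP) -def_c -map_cons.
  exact/hsym_perm/perm_map/perm_cells_add.
rewrite kQ isob_hsym //; last first.
  rewrite -map_comp.
  have /eq_in_map-> : {in [seq b <- grid | Q b], swp q \o cell =1 cell \o s}.
    by move=> b; rewrite mem_filter => /andP[_ /s_grid[]].
  rewrite map_comp; apply: perm_map; apply: uniq_perm.
  - by rewrite map_inj_uniq ?filter_uniq ?grid_uniq //; apply: inv_inj.
  - by rewrite filter_uniq ?grid_uniq.
  move=> b; rewrite -[b in LHS]sK mem_map; last exact: inv_inj.
  rewrite !mem_filter; have sb_grid : (s b \in grid) = (b \in grid).
    by apply/idP/idP => /s_grid[] // _; rewrite sK.
  rewrite sb_grid; have [b_in|] := boolP (b \in grid); rewrite ?andbF // !andbT /Q.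
  have [->|ne_bc] := eqVneq b c; first by rewrite (negPf nPsc) andbF.
  have [->|ne_bs] := eqVneq b (s c); first by rewrite sK eqxx (negPf nPsc) andbF.
  by rewrite P_s // (inv_eq sK) ne_bs andbT.
rewrite hsym_swap -def_c -def_sc -!map_cons; apply: hsym_perm; apply: perm_map.
rewrite perm_sym; apply: perm_trans (perm_cells_add _ nPsc) _; first by case: (s_grid c c_in).
rewrite perm_cons.
have eqP : {in grid, P =1 predU1 c Q}.
  by move=> b _; rewrite /= /Q; have [->|_] := eqVneq b c; rewrite ?Pc ?andbT.
rewrite (eq_in_filter eqP).
exact: perm_cells_add.
Qed.

Lemma isob_kern_x P i j d : (i.+1 < n)%N -> (j < n)%N ->
    P (i, j) -> ~~ P (i.+1, j) ->
    (forall j', (j' < n)%N -> j' != j -> P (i, j') = P (i.+1, j')) ->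
  isob i (kern P d) = kern (predU1 (i.+1, j) P) d.
Proof.
move=> lt_i lt_j Pij nPij P_s.
have lt_q : (i.+1 < n + n)%N by lia.
pose s (c : nat * nat) := (swap_nat i c.1, c.2).
have s_ij : s (i, j) = (i.+1, j) by rewrite /s /swap_nat eqxx.
have out b : (b < n)%N -> swap_nat i (n + b) = (n + b)%N.
  by rewrite /swap_nat => lt_b; do 2?case: eqP => //; lia.
rewrite -s_ij; apply: (@isob_kern _ (varX (n + n) (n + j))) => //.
- by rewrite swp_varX // out.
- by rewrite /cell mulrC.
- by rewrite s_ij /cell mulrC.
- by move=> [a b]; rewrite /s /= swap_natK.
- move=> [a b]; rewrite (mem_grid (a, b)) /= => /andP[lt_a lt_b].
  rewrite /cell swpM !swp_varX //= out // mem_grid /= lt_b andbT; split=> //.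
  by rewrite /swap_nat; do 2?case: eqP => //; lia.
- by rewrite mem_grid /= lt_j andbT; lia.
- by rewrite s_ij.
move=> [a b]; rewrite mem_grid s_ij /= => /andP[_ lt_b]; rewrite !xpair_eqE /s /= /swap_nat.
have [-> /= ne_b _|_] := eqVneq a i; first by rewrite P_s.
by have [-> /= _ ne_b|//] := eqVneq a i.+1; rewrite P_s.
Qed.

Lemma isob_kern_y P i j d : (i < n)%N -> (j.+1 < n)%N ->
    P (i, j) -> ~~ P (i, j.+1) ->
    (forall i', (i' < n)%N -> i' != i -> P (i', j) = P (i', j.+1)) ->
  isob (n + j) (kern P d) = kern (predU1 (i, j.+1) P) d.
Proof.
move=> lt_i lt_j Pij nPij P_s.
have lt_q : ((n + j).+1 < n + n)%N by lia.
pose s (c : nat * nat) := (c.1, swap_nat j c.2).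
have s_ij : s (i, j) = (i, j.+1) by rewrite /s /swap_nat eqxx.
have out a : (a < n)%N -> swap_nat (n + j) a = a.
  by rewrite /swap_nat => lt_b; do 2?case: eqP => //; lia.
have inn b : swap_nat (n + j) (n + b) = (n + swap_nat j b)%N.
  by rewrite /swap_nat; do !case: eqP => //; lia.
rewrite -s_ij; apply: (@isob_kern _ (varX (n + n) i)) => //.
- by rewrite swp_varX // out.
- by rewrite s_ij /cell addnS.
- by move=> [a b]; rewrite /s /= swap_natK.
- move=> [a b]; rewrite (mem_grid (a, b)) /= => /andP[lt_a lt_b].
  rewrite /cell swpM !swp_varX //= out // inn mem_grid /= lt_a /=; split=> //.
  by rewrite /swap_nat; do 2?case: eqP => //; lia.
- by rewrite mem_grid /= lt_i /=; lia.
- by rewrite s_ij.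
move=> [a b]; rewrite mem_grid s_ij /= => /andP[lt_a _]; rewrite !xpair_eqE /s /= /swap_nat.
have [-> /= ne_a _|_] := eqVneq b j; first by rewrite andbT in ne_a; rewrite P_s.
by have [-> /= _ ne_a|//] := eqVneq b j.+1; rewrite andbT in ne_a; rewrite P_s.
Qed.

(** By [kern_add], subtracting the old kernel leaves the part of the new one that is divisible by
    the added cell. *)
Lemma ihat_kern_x P i j d : (i.+1 < n)%N -> (j < n)%N ->
    P (i, j) -> ~~ P (i.+1, j) ->
    (forall j', (j' < n)%N -> j' != j -> P (i, j') = P (i.+1, j')) ->
  ihat i (kern P d)
  = cell (i.+1, j) * shift_seq 1 (kern (predU1 (i.+1, j) P)) d.
Proof.
move=> lt_i lt_j Pij nPij P_s; rewrite /ihat (isob_kern_x (j := j)) //.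
by rewrite kern_add // ?mem_grid ?lt_i ?lt_j // addrC addKr.
Qed.

End Kernels.

(** * Renaming of variables *)

Section Embeddings.
Local Open Scope ring_scope.
Variables n N : nat.
Implicit Types (phi psi : 'I_n -> 'I_N) (f : {mpoly int[n]}).

Definition embed phi f : {mpoly int[N]} := f \mPo [tuple 'X_(phi i) | i < n].

Lemma embedX phi i : embed phi 'X_i = 'X_(phi i).
Proof. by rewrite /embed comp_mpolyXU -tnth_nth tnth_mktuple. Qed.

Lemma embedM phi f g : embed phi (f * g) = embed phi f * embed phi g.
Proof. exact: rmorphM. Qed.

Lemma embedB phi f g : embed phi (f - g) = embed phi f - embed phi g.
Proof. exact: rmorphB. Qed.

Lemma msym_embed phi psi (s : 'S_n) (S : 'S_N) f :
  (forall i, S (phi i) = psi (s i)) -> msym S (embed phi f) = embed psi (msym s f).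
Proof.
move=> Sphi; elim/mpolyind: f => [|c m p _ _ IHp].
  by rewrite /embed msym0 !comp_mpoly0 msym0.
rewrite /embed comp_mpolyD !msymD comp_mpolyD; congr (_ + _); last exact: IHp.
rewrite comp_mpolyZ !msymZ comp_mpolyZ; congr (_ *: _).
rewrite msymX !comp_mpolyX rmorph_prod /= [RHS](reindex_inj (@perm_inj _ s)) /=.
apply: eq_bigr => i _; rewrite rmorphXn /= !tnth_mktuple mnmE permK.
by rewrite msymXU Sphi.
Qed.

Lemma msym_embed1 phi psi (S : 'S_N) f :
  (forall i, S (phi i) = psi i) -> msym S (embed phi f) = embed psi f.
Proof.
move=> Sphi; rewrite (@msym_embed phi psi 1%g) ?msym1m // => i.
by rewrite perm1.
Qed.

Lemma isobaric_embed phi (r : 'I_n.-1) (q : 'I_N.-1) f : injective phi ->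
    phi (lo r) = lo q -> phi (hi r) = hi q ->
  isobaric q (embed phi f) = embed phi (isobaric r f).
Proof.
move=> phi_inj def_lo def_hi; apply: isobaric_unique.
rewrite (@msym_embed phi phi (simple_tperm r)) => [|i]; last first.
  rewrite /simple_tperm -def_lo -def_hi; case: tpermP => [/phi_inj->|/phi_inj->|].
  - by rewrite tpermL.
  - by rewrite tpermR.
  by move=> ne1 ne2; rewrite tpermD //; apply/eqP => e; [apply: ne1|apply: ne2]; rewrite e.
have := congr1 (embed phi) (isobaric_divE r f).
by rewrite !(embedM, embedB, embedX) def_lo def_hi.
Qed.

Lemma embed_homog phi f d : f \is d.-homog for mdeg -> embed phi f \is d.-homog for mdeg.
Proof.
move=> hf; rewrite /embed comp_mpolyE big_seq; apply: rpred_sum => m m_in.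
apply: rpredZ; have <- := dhomog_mf hf m_in; rewrite /= mdegE.
apply: (big_ind2 (fun (p : {mpoly int[N]}) (e : nat) => p \is e.-homog for mdeg)).
- exact: dhomog1.
- by move=> p e q e' hp hq; apply: dhomogM.
move=> i _; rewrite tnth_mktuple -[X in ishomog1 X]mul1n; apply: dhomogMn.
by rewrite dhomogX; apply/eqP; exact: mdeg1.
Qed.

End Embeddings.

(** * Operators acting on one of the two alphabets *)

Section TwoAlphabetOperators.
Local Open Scope ring_scope.
Variable n : nat.
Implicit Types (f g : {mpoly int[n]}).

Lemma in_xE f : in_x f = embed (lshift n) f. Proof. by []. Qed.
Lemma in_yE f : in_y f = embed (@rshift n n) f. Proof. by []. Qed.

Lemma isob_in_x j f g : (j.+1 < n)%N ->
  isob j (in_x f * in_y g) = in_x (isob j f) * in_y g.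
Proof.
move=> lt_j; have lt_r : (j < n.-1)%N by lia.
have lt_q : (j < (n + n).-1)%N by lia.
rewrite mulrC [RHS]mulrC isobM.
  rewrite -[j in LHS]/(val (Ordinal lt_q)) -[j in RHS]/(val (Ordinal lt_r)) !isob_ord.
  congr (_ * _); apply: (isobaric_embed _ (@lshift_inj _ _)); exact: val_inj.
rewrite -[j]/(val (Ordinal lt_q)) swp_ord; apply: msym_embed1 => i.
rewrite /simple_tperm tpermD // -val_eqE /=; lia.
Qed.

Lemma isob_in_y j f g : (j.+1 < n)%N ->
  isob (n + j) (in_x f * in_y g) = in_x f * in_y (isob j g).
Proof.
move=> lt_j; have lt_r : (j < n.-1)%N by lia.
have lt_q : (n + j < (n + n).-1)%N by lia.
rewrite isobM.
  rewrite -[(n + j)%N in LHS]/(val (Ordinal lt_q)) -[j in RHS]/(val (Ordinal lt_r)).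
  rewrite !isob_ord; congr (_ * _).
  by apply: (isobaric_embed _ (@rshift_inj _ _)); apply: val_inj => //=; rewrite addnS.
rewrite -[(n + j)%N]/(val (Ordinal lt_q)) swp_ord; apply: msym_embed1 => i.
rewrite /simple_tperm tpermD // -val_eqE /=; have := ltn_ord i; lia.
Qed.

Lemma ihat_in_x j f g : (j.+1 < n)%N ->
  ihat j (in_x f * in_y g) = in_x (ihat j f) * in_y g.
Proof. by move=> lt_j; rewrite /ihat isob_in_x // -mulrBl /in_x rmorphB. Qed.

Lemma in_xy_homog f g d e : f \is d.-homog for mdeg -> g \is e.-homog for mdeg ->
  in_x f * in_y g \is (d + e).-homog for mdeg.
Proof. by move=> hf hg; apply: dhomogM; apply: embed_homog. Qed.

End TwoAlphabetOperators.

(** * Keys and atoms of compositions given as sequences *)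

Section Compositions.
Local Open Scope ring_scope.
Variable n : nat.
Implicit Types (u v s : seq nat) (a b : nat).

Lemma compoE s (i : 'I_n) : compo n s i = nth 0%N s i.
Proof. by rewrite mnmE. Qed.

Lemma compo_cat0 s k : compo n (s ++ nseq k 0%N) = compo n s.
Proof.
apply/mnmP => i; rewrite !compoE nth_cat nth_nseq if_same.
by case: ltnP => // le; rewrite nth_default.
Qed.

Lemma mswap_compo u a b v (lt_u : (size u < n.-1)%N) :
  mswap (Ordinal lt_u) (compo n (u ++ a :: b :: v)) = compo n (u ++ b :: a :: v).
Proof.
apply/mnmP => i; rewrite mpermE !compoE /simple_tperm !nth_cat.
case: tpermP => [->|->|/eqP ne1 /eqP ne2] /=.
- by rewrite !ltnNge leqnn leqnSn /= subnn subSn // subnn.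
- by rewrite !ltnNge leqnn leqnSn /= subnn subSn // subnn.
rewrite -!val_eqE /= in ne1 ne2; case: ltnP => // le_ui.
by case e: (i - size u)%N => [|[|k]] //=; lia.
Qed.

Lemma compo_lo u a b v (lt_u : (size u < n.-1)%N) :
  compo n (u ++ a :: b :: v) (lo (Ordinal lt_u)) = a.
Proof. by rewrite compoE nth_cat /= ltnn subnn. Qed.

Lemma compo_hi u a b v (lt_u : (size u < n.-1)%N) :
  compo n (u ++ a :: b :: v) (hi (Ordinal lt_u)) = b.
Proof. by rewrite compoE nth_cat /= ltnNge leqnSn subSn // subnn. Qed.

Lemma isob_key u a b v : ((size u).+1 < n)%N ->
  isob (size u) (key (compo n (u ++ a :: b :: v)))
  = key (compo n (u ++ minn a b :: maxn a b :: v)).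
Proof.
move=> lt_u; have lt_r : (size u < n.-1)%N by lia.
rewrite -[size u in LHS]/(val (Ordinal lt_r)) isob_ord isobaric_key compo_lo compo_hi.
by case: ltnP => // lt_ba; rewrite mswap_compo.
Qed.

Lemma ihat_atom_desc u a b v : ((size u).+1 < n)%N -> (b < a)%N ->
  ihat (size u) (atom (compo n (u ++ a :: b :: v))) = atom (compo n (u ++ b :: a :: v)).
Proof.
move=> lt_u lt_ba; have lt_r : (size u < n.-1)%N by lia.
rewrite -[size u in LHS]/(val (Ordinal lt_r)) ihat_ord isobaric_hat_atom_desc ?mswap_compo //.
by rewrite compo_lo compo_hi.
Qed.

Lemma ihat_atom_eq u a v : ((size u).+1 < n)%N ->
  ihat (size u) (atom (compo n (u ++ a :: a :: v))) = 0.
Proof.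
move=> lt_u; have lt_r : (size u < n.-1)%N by lia.
rewrite -[size u in LHS]/(val (Ordinal lt_r)) ihat_ord isobaric_hat_atom_eq //.
by rewrite compo_lo compo_hi.
Qed.

(** The largest index acts first, so the zero travels leftwards through [t]. *)
Lemma foldr_isob_key0 u t v : (size u + size t < n)%N ->
  foldr (@isob n) (key (compo n (u ++ t ++ 0%N :: v))) (iota (size u) (size t))
  = key (compo n (u ++ 0%N :: t ++ v)).
Proof.
elim: t u => //= a t IHt u lt_n.
have /= := IHt (rcons u a); rewrite size_rcons !cat_rcons => -> //; last by lia.
by rewrite isob_key ?minn0 ?maxn0 //; lia.
Qed.

(** The zero travels leftwards as for keys, but meeting another zero creates equal neighbours, and
    the atom is killed. *)
Lemma foldr_ihat_atom0 u t v : (size u + size t < n)%N ->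
  foldr (@ihat n) (atom (compo n (u ++ t ++ 0%N :: v))) (iota (size u) (size t))
  = if all (leq 1) t then atom (compo n (u ++ 0%N :: t ++ v)) else 0.
Proof.
elim: t u => //= a t IHt u lt_n.
have /= := IHt (rcons u a); rewrite size_rcons !cat_rcons => -> //; last by lia.
case: all; last by rewrite andbF ihat0.
rewrite andbT; case: posnP => [->|a_gt0]; first by rewrite ihat_atom_eq //; lia.
by rewrite ihat_atom_desc //; lia.
Qed.

Definition ones k : 'X_{1..n} := compo n (nseq k 1%N).

Lemma ones_ltn k (i : 'I_n) : ones k i = (i < k)%N.
Proof. by rewrite compoE nth_nseq; case: ltnP. Qed.

Lemma compo_map_succ s : compo n (map succn s) = (compo n s + ones (size s))%MM.
Proof.
apply/mnmP => i; rewrite mnmDE ones_ltn !compoE.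
have [lt|le] := ltnP i (size s); first by rewrite (nth_map 0%N) // addn1.
by rewrite !nth_default ?size_map.
Qed.

Lemma key_map_succ s : key (compo n (map succn s)) = 'X_[ones (size s)] * key (compo n s).
Proof.
rewrite compo_map_succ; apply: (ascent_rec_shift _ (@key_ascent_rec n) (k := size s)).
- by move=> r f g; apply: isobaricM.
- exact: ones_ltn.
by move=> i le_i; rewrite compoE nth_default.
Qed.

Lemma atom_map_succ s : atom (compo n (map succn s)) = 'X_[ones (size s)] * atom (compo n s).
Proof.
rewrite compo_map_succ; apply: (ascent_rec_shift _ (@atom_ascent_rec n) (k := size s)).
- by move=> r f g; apply: isobaric_hatM.
- exact: ones_ltn.
by move=> i le_i; rewrite compoE nth_default.
Qed.

Lemma mdeg_compo s : (size s <= n)%N -> mdeg (compo n s) = sumn s.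
Proof.
move=> le_s; rewrite mdegE sumnE.
under eq_bigr => i _ do rewrite compoE.
rewrite -(big_mkord predT (fun i => nth 0%N s i)) (@big_cat_nat _ _ _ (size s)) //=.
rewrite [X in (_ + X)%N]big_nat_cond [X in (_ + X)%N]big1 ?addn0; last first.
  by move=> i; rewrite andbT => /andP[le_i _]; rewrite nth_default.
by rewrite [RHS](big_nth 0%N).
Qed.

Lemma key_homog s : (size s <= n)%N ->
  key (compo n s) \is (sumn s).-homog for mdeg.
Proof.
move=> le_s; rewrite -(mdeg_compo le_s).
by apply: ascent_rec_homog (@key_ascent_rec n); apply: isobaric_homog.
Qed.

Lemma atom_homog s : (size s <= n)%N ->
  atom (compo n s) \is (sumn s).-homog for mdeg.
Proof.
move=> le_s; rewrite -(mdeg_compo le_s).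
by apply: ascent_rec_homog (@atom_ascent_rec n); apply: isobaric_hat_homog.
Qed.

End Compositions.

(** * The staircase *)

Section Staircase.
Local Open Scope ring_scope.

Fixpoint comps k d : seq (seq nat) :=
  if k is k'.+1 then [seq c :: s | c <- iota 0 d.+1, s <- comps k' (d - c)%N]
  else if d is 0%N then [:: [::]] else [::].

Lemma mem_comps k d s : (s \in comps k d) = (size s == k) && (sumn s == d).
Proof.
elim: k d s => [|k IHk] d s; first by case: d; case: s.
rewrite [comps _ _](erefl [seq c :: t | c <- iota 0 d.+1, t <- comps k (d - c)%N]).
apply/allpairsPdep/idP => [[c [t []]]|].
  by rewrite mem_iota IHk => lt_c /andP[/eqP <- /eqP e] -> /=; rewrite eqxx e; lia.
case: s => // c s; rewrite [size _]/= [sumn _]/= eqSS => /andP[size_s /eqP sum_s].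
exists c, s; rewrite IHk size_s mem_iota; split=> //; first lia.
by apply/eqP; lia.
Qed.

Lemma comps_uniq k d : uniq (comps k d).
Proof.
elim: k d => [|k IHk] d; first by case: d.
apply: allpairs_uniq_dep; rewrite ?iota_uniq //.
by move=> [c s] [c' s'] _ _ /= [-> ->].
Qed.

#[local] Arguments comps : simpl never.

Variable n : nat.
Local Notation R := {mpoly int[n + n]}.
Implicit Types (mu nu : seq nat) (i j k d : nat).

Definition cauchy_term mu : R :=
  in_x (atom (compo n mu)) * in_y (key (compo n (rev mu))).
Definition staircase_sum k d : R := \sum_(mu <- comps k d) cauchy_term mu.

Lemma foldr_ihat_in_x w (f g : {mpoly int[n]}) : all (fun j => j.+1 < n)%N w ->
  foldr (@ihat (n + n)) (in_x f * in_y g) w = in_x (foldr (@ihat n) f w) * in_y g.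
Proof. by elim: w => //= j w IHw /andP[lt_j /IHw ->]; rewrite ihat_in_x. Qed.

Lemma foldr_isob_in_y w (f g : {mpoly int[n]}) : all (fun j => j.+1 < n)%N w ->
  foldr (@isob (n + n)) (in_x f * in_y g) (map (addn n) w)
  = in_x f * in_y (foldr (@isob n) g w).
Proof. by elim: w => //= j w IHw /andP[lt_j /IHw ->]; rewrite isob_in_y. Qed.

Lemma foldr_isob_sum N w I (s : seq I) (F : I -> {mpoly int[N]}) :
  foldr (@isob N) (\sum_(i <- s) F i) w = \sum_(i <- s) foldr (@isob N) (F i) w.
Proof. by elim: w => //= j w ->; rewrite isob_sum. Qed.

Lemma foldr_ihat_sum N w I (s : seq I) (F : I -> {mpoly int[N]}) :
  foldr (@ihat N) (\sum_(i <- s) F i) w = \sum_(i <- s) foldr (@ihat N) (F i) w.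
Proof. by elim: w => //= j w ->; rewrite ihat_sum. Qed.

(* Sends the term of [nu] to the term of [nu] with a zero inserted at position
   [j], provided that this becomes the last zero, and to 0 otherwise. *)
Definition insert_op k j (F : R) : R :=
  foldr (@ihat (n + n)) (foldr (@isob (n + n)) F (map (addn n) (iota (k - j) j)))
    (iota j (k - j)).

Definition insert_zero j nu := take j nu ++ 0%N :: drop j nu.

(** A zero appended to [nu] or to [rev nu] does not change the exponent. The two words move these
    zeros to positions j and k - j, which correspond under reversal of k + 1 entries. *)
Lemma insert_op_term k j nu : (j <= k < n)%N -> size nu = k ->
  insert_op k j (cauchy_term nu)
  = if all (leq 1) (drop j nu) then cauchy_term (insert_zero j nu) else 0.
Proof.
move=> /andP[le_jk lt_kn] size_nu.
have lt_w p q : (p + q <= k)%N -> all (fun j => j.+1 < n)%N (iota p q).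
  by move=> le_pq; apply/allP => i; rewrite mem_iota; lia.
rewrite /insert_op /cauchy_term foldr_isob_in_y ?foldr_ihat_in_x ?lt_w //; try lia.
have size_t : size (take j nu) = j by rewrite size_takel ?size_nu.
have size_d : size (drop j nu) = (k - j)%N by rewrite size_drop size_nu.
have -> : foldr (@ihat n) (atom (compo n nu)) (iota j (k - j))
    = if all (leq 1) (drop j nu) then atom (compo n (insert_zero j nu)) else 0.
  have := @foldr_ihat_atom0 n (take j nu) (drop j nu) [::].
  rewrite size_t size_d cats0 catA cat_take_drop => <-; last lia.
  by rewrite (compo_cat0 n nu 1).
have -> : foldr (@isob n) (key (compo n (rev nu))) (iota (k - j) j)
    = key (compo n (rev (insert_zero j nu))).
  have := @foldr_isob_key0 n (rev (drop j nu)) (rev (take j nu)) [::].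
  rewrite !size_rev size_t size_d cats0 catA -rev_cat cat_take_drop.
  rewrite (compo_cat0 n (rev nu) 1) => -> //; last lia.
  by rewrite /insert_zero rev_cat rev_cons cat_rcons.
by case: all => //; rewrite /in_x comp_mpoly0 mul0r.
Qed.

Lemma last_zero mu : ~~ all (leq 1) mu ->
  exists s t, mu = s ++ 0%N :: t /\ all (leq 1) t.
Proof.
elim: mu => //= a mu IHmu; have [pos_mu|/IHmu[s [t [-> pos_t]]] _] := boolP (all _ mu).
  by rewrite andbT -eqn0Ngt => /eqP ->; exists [::], mu.
by exists (a :: s), t.
Qed.

(** The inserted zero is the last one, so its position recovers [j]. *)
Lemma insert_zero_inj j j' nu nu' : (j <= size nu)%N -> (j' <= size nu')%N ->
    all (leq 1) (drop j nu) -> all (leq 1) (drop j' nu') ->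
  insert_zero j nu = insert_zero j' nu' -> j = j' /\ nu = nu'.
Proof.
have idx i s : (i <= size s)%N -> all (leq 1) (drop i s) ->
    (size (insert_zero i s) - (index 0%N (rev (insert_zero i s))).+1 = i)%N.
  move=> le_i pos_d; rewrite /insert_zero rev_cat rev_cons cat_rcons index_cat.
  rewrite ifN; last by rewrite mem_rev; apply/negP => /(allP pos_d).
  by rewrite /= addn0 size_rev size_cat /= size_takel // size_drop; lia.
move=> le_j le_j' pos pos' e; have ej : j = j' by rewrite -(idx j nu) // e idx.
split=> //; move: e; rewrite /insert_zero -ej => /eqP.
rewrite eqseq_cat; last by rewrite !size_takel // ej.
by rewrite eqseq_cons => /and3P[/eqP t _ /eqP d]; rewrite -(cat_take_drop j nu) t d cat_take_drop.
Qed.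

(** The compositions with a zero are sorted by the position [j] of the last one, whose deletion
    gives [nu]. *)
Lemma staircase_sum_zero k d : (k < n)%N ->
  \sum_(mu <- comps k.+1 d | ~~ all (leq 1) mu) cauchy_term mu
  = \sum_(0 <= j < k.+1) insert_op k j (staircase_sum k d).
Proof.
move=> lt_kn; have inner j : (0 <= j < k.+1)%N ->
    insert_op k j (staircase_sum k d)
    = \sum_(nu <- [seq nu <- comps k d | all (leq 1) (drop j nu)])
         cauchy_term (insert_zero j nu).
  move=> /andP[_ lt_j]; rewrite big_filter big_mkcond big_seq /insert_op.
  rewrite foldr_isob_sum foldr_ihat_sum big_seq; apply: eq_bigr => nu.
  rewrite mem_comps => /andP[/eqP size_nu _].
  by rewrite -/(insert_op k j (cauchy_term nu)) insert_op_term //; lia.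
rewrite (eq_big_nat _ _ inner) -[LHS]big_filter.
transitivity (\sum_(mu <- [seq insert_zero j nu | j <- index_iota 0 k.+1,
  nu <- [seq nu <- comps k d | all (leq 1) (drop j nu)]]) cauchy_term mu); last first.
  by rewrite big_allpairs_dep.
have in_nu j nu : nu \in [seq nu <- comps k d | all (leq 1) (drop j nu)] ->
    [/\ all (leq 1) (drop j nu), size nu = k & sumn nu = d].
  by rewrite mem_filter mem_comps => /andP[? /andP[/eqP ? /eqP ?]].
apply: perm_big; apply: uniq_perm.
- exact/filter_uniq/comps_uniq.
- apply: allpairs_uniq_dep => [||[j nu] [j' nu']]; first exact: iota_uniq.
    by move=> j _; apply/filter_uniq/comps_uniq.
  move=> /allpairsPdep[j1 [nu1 [j_in nu_in e1]]].
  move=> /allpairsPdep[j2 [nu2 [j_in' nu_in' e2]]].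
  (* Equalities of dependent pairs are split into components; the family of second components is
     constant. *)
  have [] := (congr1 tag e1, congr1 (fun p : {_ : nat & seq nat} => tagged p) e1).
  have [] := (congr1 tag e2, congr1 (fun p : {_ : nat & seq nat} => tagged p) e2).
  move=> /= -> -> -> ->; move: j_in j_in'; rewrite !mem_index_iota /= => j_in j_in'.
  have [pos size_nu _] := in_nu _ _ nu_in; have [pos' size_nu' _] := in_nu _ _ nu_in'.
  have le1 : (j1 <= size nu1)%N by rewrite size_nu.
  have le2 : (j2 <= size nu2)%N by rewrite size_nu'.
  by case/insert_zero_inj => // -> ->.
move=> mu; rewrite mem_filter mem_comps.
apply/andP/allpairsPdep => [[/last_zero[s [t [-> pos_t]]]]|].
  rewrite size_cat sumn_cat /= addnS eqSS => /andP[/eqP size_st /eqP sum_st].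
  exists (size s), (s ++ t); rewrite mem_filter mem_comps mem_index_iota.
  rewrite /insert_zero drop_size_cat // take_size_cat // pos_t size_cat sumn_cat.
  by rewrite size_st sum_st !eqxx; split=> //; lia.
move=> [j [nu [/= j_in /in_nu[pos size_nu sum_nu] ->]]].
rewrite mem_index_iota in j_in.
rewrite /insert_zero all_cat /= andbF size_cat sumn_cat /= addnS add0n.
by rewrite -size_cat -sumn_cat cat_take_drop size_nu sum_nu !eqxx.
Qed.

Lemma big_comps_pos k d (F : seq nat -> R) :
  \sum_(mu <- comps k d | all (leq 1) mu) F mu
  = shift_seq k (fun e => \sum_(nu <- comps k e) F (map succn nu)) d.
Proof.
have sum_succ nu : sumn (map succn nu) = (sumn nu + size nu)%N.
  by elim: nu => //= a nu ->; lia.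
rewrite -big_filter /shift_seq; case: leqP => [le_kd|lt_dk]; last first.
  rewrite big_seq big1 // => mu; rewrite mem_filter mem_comps.
  move=> /andP[pos_mu /andP[/eqP size_mu /eqP sum_mu]].
  suff : (size mu <= sumn mu)%N by lia.
  by elim: (mu) pos_mu => //= a s IHs /andP[a_gt0 /IHs]; lia.
rewrite -(big_map (map succn) xpredT F); apply: perm_big; apply: uniq_perm.
- exact/filter_uniq/comps_uniq.
- by rewrite map_inj_uniq ?comps_uniq //; apply: inj_map; apply: succn_inj.
move=> mu; rewrite mem_filter mem_comps.
apply/andP/mapP => [[pos_mu /andP[/eqP size_mu /eqP sum_mu]]|[nu nu_in ->]].
  have def_mu : mu = map succn (map predn mu).
    rewrite -map_comp -[LHS]map_id; apply/eq_in_map => a /(allP pos_mu).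
    by case: a.
  exists (map predn mu) => //; rewrite mem_comps size_map size_mu eqxx /=.
  by move: sum_mu; rewrite {1}def_mu sum_succ size_map size_mu => <-; rewrite addnK.
move: nu_in; rewrite mem_comps => /andP[/eqP size_nu /eqP sum_nu].
rewrite size_map sum_succ size_nu sum_nu subnK // !eqxx; split=> //.
by apply/allP => _ /mapP[a _ ->].
Qed.

Definition rho k : pred (nat * nat) := fun c => (c.1 + c.2 < k)%N.
(** Cells on the antidiagonal that separates [rho k] from [rho k.+1]: the t_i of the overview with k
    + 1 in place of k and rows numbered from 0. *)
Definition diag_prod k j : R := \prod_(j <= i < k.+1) cell n (i, k - i)%N.

(* Between [rho k] and [rho k.+1]: rows before [j] or after [i] are full. *)
Definition rho_mix k j i : pred (nat * nat) :=
  fun c => (c.1 + c.2 < k + ((c.1 < j) || (i < c.1)))%N.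

(** The largest index acts first; the operators add the antidiagonal cells of rows 0, ..., j - 1 in
    this order. *)
Lemma insert_op_y_kern k j d : (j <= k < n)%N ->
  foldr (@isob (n + n)) (kern n (rho k) d) (map (addn n) (iota (k - j) j))
  = kern n (rho_mix k j k) d.
Proof.
move=> /andP[le_jk lt_kn]; elim: j le_jk => [_|j IHj lt_jk] /=.
  by apply: eq_kern => -[a b] _; rewrite /rho /rho_mix /=; lia.
have -> : ((k - j.+1).+1 = k - j)%N by lia.
rewrite IHj; last exact: ltnW.
rewrite (isob_kern_y (i := j)) /rho_mix /=; try lia.
by apply: eq_kern => -[a b] _; rewrite /= xpair_eqE; lia.
Qed.

(** Starting with row k and going back, each hat operator adds the antidiagonal cell of one row and
    also pulls it out as a factor, which costs one degree. *)
Lemma insert_op_x_kern k j q d : (k < n)%N -> (j + q <= k)%N ->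
  foldr (@ihat (n + n)) (kern n (rho_mix k j k) d) (iota (k - q) q)
  = diag_prod k (k - q).+1 * shift_seq q (kern n (rho_mix k j (k - q))) d.
Proof.
move=> lt_kn; elim: q => [|q IHq] le_jq /=.
  by rewrite subn0 /diag_prod big_geq // mul1r shift_seq0.
have -> : ((k - q.+1).+1 = k - q)%N by lia.
rewrite IHq; last lia.
set i := (k - q.+1)%N; have def_i : (k - q = i.+1)%N by rewrite /i; lia.
have lt_ik : (i < k)%N by lia.
(* The factors pulled out so far come from rows beyond i + 1, so they are fixed by the exchange of
   the x variables of rows i and i + 1. *)
rewrite def_i ihatM; last first.
  rewrite /diag_prod big_nat; elim/big_rec: _ => [|a f /andP[lt_ia lt_ak] IHf].
    have [[r ->]|out] := index_ordP (n + n) i; last by rewrite swp_out.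
    by rewrite swp_ord msym1.
  by rewrite swpM IHf /cell swpM !swp_varX /swap_nat /=; try lia;
     congr (_ * _ * _); congr varX; do !case: eqP; lia.
rewrite [diag_prod k i.+1]big_ltn // -/(diag_prod k i.+2) (mulrC (cell _ _)) -mulrA.
congr (_ * _); rewrite /shift_seq; have [le_qd|lt_dq] := leqP q d; last first.
  by rewrite ihat0 ltnNge (ltnW lt_dq) mulr0.
rewrite (ihat_kern_x (j := k - i.+1)) /rho_mix /=; try lia.
congr (_ * _); rewrite /shift_seq; have -> : (0 < d - q)%N = (q < d)%N by lia.
case: ifP => // _; rewrite -subnDA addn1.
by apply: eq_kern => -[a b] _; rewrite /= xpair_eqE; lia.
Qed.

(** In [rho_mix k j j] only row j lacks its antidiagonal cell t_j, so its kernel is (1 - t_j) times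
    that of [rho k.+1]. Absorbing t_j into the product gives a telescoping difference. *)
Lemma insert_op_kern k j d : (j <= k < n)%N ->
  insert_op k j (kern n (rho k) d)
  = diag_prod k j.+1 * shift_seq (k - j) (kern n (rho k.+1)) d
    - diag_prod k j * shift_seq (k.+1 - j) (kern n (rho k.+1)) d.
Proof.
move=> /andP[le_jk lt_kn]; rewrite /insert_op insert_op_y_kern ?le_jk //.
have := @insert_op_x_kern k j (k - j) d lt_kn; rewrite subKn // subnKC // => -> //.
have kE e : kern n (rho_mix k j j) e
    = kern n (rho k.+1) e - cell n (j, k - j)%N * shift_seq 1 (kern n (rho k.+1)) e.
  have eqP : {in grid n, rho k.+1 =1 predU1 (j, k - j)%N (rho_mix k j j)}.
    by move=> [a b] _; rewrite /rho /rho_mix /= xpair_eqE; lia.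
  rewrite (eq_kern eqP) kern_add ?mem_grid /rho_mix /=; try lia.
  rewrite [X in _ - _ * X](@eq_shift_seq _ 1 _ (kern n (predU1 (j, k - j)%N (rho_mix k j j)))).
    by rewrite addrK.
  by move=> e' _; apply: eq_kern.
rewrite [diag_prod k j]big_ltn // -/(diag_prod k j.+1) (mulrC (cell _ _)) -mulrA -mulrBr.
congr (_ * _); rewrite subSn // -(addn1 (k - j)) -(shift_seqD (k - j) 1).
by rewrite {1 2 3}/shift_seq; case: leqP => _; rewrite ?mulr0 ?subrr // kE.
Qed.

Lemma sum_insert_op_kern k d : (k < n)%N ->
  \sum_(0 <= j < k.+1) insert_op k j (kern n (rho k) d)
  = kern n (rho k.+1) d - diag_prod k 0 * shift_seq k.+1 (kern n (rho k.+1)) d.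
Proof.
move=> lt_kn.
pose F j := diag_prod k j * shift_seq (k.+1 - j) (kern n (rho k.+1)) d.
rewrite (eq_big_nat _ _ (F2 := fun j => F j.+1 - F j)).
  by rewrite telescope_sumr // /F subnn /diag_prod big_geq // mul1r shift_seq0 subn0.
by move=> j /andP[_ lt_j]; rewrite insert_op_kern // -ltnS lt_j.
Qed.

Lemma embed_ones (phi : 'I_n -> 'I_(n + n)) k : (k <= n)%N ->
  embed phi 'X_[ones n k] = \prod_(i < k) oapp (fun a : 'I_n => 'X_(phi a)) 1 (insub (i : nat)).
Proof.
move=> le_kn; rewrite /embed comp_mpolyX.
rewrite (big_ord_widen _ (fun i => oapp (fun a : 'I_n => 'X_(phi a)) 1 (insub i)) le_kn).
rewrite [RHS]big_mkcond; apply: eq_bigr => i _; rewrite tnth_mktuple ones_ltn valK.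
by case: ltnP.
Qed.

Lemma diag_prod0 k : (k < n)%N ->
  diag_prod k 0 = in_x 'X_[ones n k.+1] * in_y 'X_[ones n k.+1].
Proof.
move=> lt_kn; rewrite in_xE in_yE !embed_ones // /diag_prod /cell big_split /=.
congr (_ * _); last rewrite big_nat_rev /=; rewrite big_mkord; apply: eq_bigr => i _.
  have lt_in : (i < n)%N by have := ltn_ord i; lia.
  have lt_in2 : (i < n + n)%N by lia.
  rewrite -[i : nat]/(val (Ordinal lt_in)) valK /= -[i : nat]/(val (Ordinal lt_in2)) varX_ord.
  by congr 'X_(_); apply: val_inj.
have lt_in : (i < n)%N by have := ltn_ord i; lia.
have lt_in2 : (n + i < n + n)%N by rewrite ltn_add2l.
have -> : (k - (0 + k.+1 - i.+1) = i)%N by have := ltn_ord i; lia.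
rewrite -[i : nat]/(val (Ordinal lt_in)) valK /= -[(n + i)%N]/(val (Ordinal lt_in2)) varX_ord.
by congr 'X_(_); apply: val_inj.
Qed.

Lemma cauchy_term_succ nu :
  cauchy_term (map succn nu)
  = in_x 'X_[ones n (size nu)] * in_y 'X_[ones n (size nu)] * cauchy_term nu.
Proof.
rewrite /cauchy_term -map_rev atom_map_succ key_map_succ size_rev.
by rewrite !in_xE !in_yE !embedM mulrACA.
Qed.

Theorem staircase_cauchy k d : (k <= n)%N -> staircase_sum k d = kern n (rho k) d.
Proof.
elim: k d => [|k IHk] d lt_kn.
  rewrite /staircase_sum /kern (eq_filter (a2 := pred0)) => [|c]; last by rewrite /rho.
  rewrite filter_pred0 /comps /=; case: d => [|d]; last by rewrite big_nil.
  rewrite big_seq1 /cauchy_term.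
  have no_asc (r : 'I_n.-1) : (compo n [::] (lo r) < compo n [::] (hi r))%N = false.
    by rewrite !compoE !nth_nil.
  have c0 : compo n [::] = 0%MM by apply/mnmP => i; rewrite compoE nth_nil mnm0E.
  rewrite atomE keyE (eq_pick no_asc); case: pickP => // _.
  by rewrite c0 mpolyX0 /in_x /in_y !comp_mpoly1 mulr1.
(* Inner induction on the degree: the terms with all entries positive reproduce the whole sum in
   degree d - (k + 1). *)
have [l] := ubnP d; elim: l d => // l IHl d /ltnSE le_dl.
rewrite /staircase_sum (bigID (all (leq 1))) /= staircase_sum_zero //.
under [X in _ + X]eq_bigr => j _ do rewrite IHk ?(ltnW lt_kn) //.
rewrite sum_insert_op_kern // big_comps_pos.
suff -> : shift_seq k.+1 (fun e => \sum_(nu <- comps k.+1 e) cauchy_term (map succn nu)) d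
    = diag_prod k 0 * shift_seq k.+1 (kern n (rho k.+1)) d by rewrite addrC subrK.
rewrite /shift_seq; have [lt_kd|lt_dk] := leqP k.+1 d; last by rewrite mulr0.
rewrite -IHl; last lia.
rewrite diag_prod0 // /staircase_sum mulr_sumr big_seq [RHS]big_seq.
apply: eq_bigr => nu; rewrite mem_comps => /andP[/eqP size_nu _].
by rewrite cauchy_term_succ size_nu.
Qed.

End Staircase.

(** * Bubble sort and successive maxima *)

Section SelectMax.
Implicit Types (s t w : seq nat) (a x p l : nat).

(** One pass of bubble sort, [x] being the entry carried along; on a sorted [w] it is insertion. *)
Fixpoint bubble x w :=
  if w is b :: w' then minn x b :: bubble (maxn x b) w' else [:: x].

Definition bubble_step p x w := bubble x (take p w) ++ drop p w.

Lemma perm_bubble x w : perm_eq (bubble x w) (x :: w).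
Proof.
elim: w x => //= b w IHw x; apply: perm_trans (_ : perm_eq _ (minn x b :: maxn x b :: w)) _.
  by rewrite perm_cons.
rewrite -[minn _ _ :: _]/([:: minn x b; maxn x b] ++ w) -[x :: _]/([:: x; b] ++ w).
rewrite perm_cat2r; case: (leqP x b) => _ //.
by rewrite (perm_catC [:: b] [:: x]).
Qed.

Lemma sorted_bubble x w : sorted leq w -> sorted leq (bubble x w).
Proof.
rewrite !(sorted_pairwise leq_trans); elim: w x => //= b w IHw x /andP[le_bw pw].
rewrite IHw // andbT (perm_all _ (perm_bubble _ _)) /= leq_max geq_minl /=.
by apply: sub_all le_bw => c; apply: leq_trans; apply: geq_minr.
Qed.

Lemma bubble_nseq0 x z w : bubble x (nseq z 0 ++ w) = nseq z 0 ++ bubble x w.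
Proof. by elim: z => //= z IHz; rewrite minn0 maxn0 IHz. Qed.

Lemma bigmax_mem s : s != [::] -> \max_(b <- s) b \in s.
Proof.
elim: s => // a s IHs _; rewrite big_cons inE.
have [->|/IHs max_s] := eqVneq s [::]; first by rewrite big_nil maxn0 eqxx.
by rewrite /maxn; case: ifP; rewrite ?eqxx ?max_s ?orbT.
Qed.

Lemma size_select_max p l s : size (select_max p l s) = l.
Proof. by elim: l s => //= l IHl s; rewrite size_rcons IHl. Qed.

Lemma select_max_sort p l s : size s = l -> l <= p ->
  sorted leq (select_max p l s) /\ perm_eq (select_max p l s) s.
Proof.
elim: l s => [|l IHl] s; first by case: s.
move=> size_s le_lp /=; rewrite (minn_idPl le_lp) subnn take0 drop0 /=.
set a := \max_(b <- s) b; have a_in : a \in s by apply: bigmax_mem; case: (s) size_s.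
have size_rem_s : size (rem a s) = l by rewrite size_rem // size_s.
have [] := IHl _ size_rem_s (ltnW le_lp).
rewrite !(sorted_pairwise leq_trans) => srt prm; split; last first.
  by rewrite perm_rcons perm_sym (perm_trans (perm_to_rem a_in)) // perm_cons perm_sym.
rewrite pairwise_rcons srt andbT (perm_all _ prm); apply/allP => b /mem_rem b_in.
exact: (@leq_bigmax_seq _ s xpredT id).
Qed.

(** If all of [x :: s] fits into the window, both sides are sorted rearrangements of it. Otherwise
    [x] is outside the first window, the same maximum is selected with and without [x], and
    induction applies. *)
Lemma select_max_cons p l x s : size s = l ->
  select_max p.+1 l.+1 (x :: s) = bubble_step p x (select_max p.+1 l s).
Proof.
have small t : size t <= p ->
    select_max p.+1 (size t).+1 (x :: t) = bubble_step p x (select_max p.+1 (size t) t).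
  move=> le_tp; have [srt prm] := select_max_sort (erefl (size t)) (leqW le_tp).
  have [srt' prm'] := select_max_sort (erefl (size (x :: t))) (le_tp : size (x :: t) <= p.+1).
  apply: (sorted_eq leq_trans anti_leq) => //.
    rewrite /bubble_step take_oversize ?drop_oversize ?size_select_max //.
    by rewrite cats0; apply: sorted_bubble.
  apply: (perm_trans prm'); rewrite perm_sym /bubble_step.
  rewrite take_oversize ?drop_oversize ?size_select_max //.
  by rewrite cats0 (perm_trans (perm_bubble _ _)) // perm_cons.
elim: l s => [|l IHl] s size_s; first by rewrite -size_s small ?size_s.
have [le_lp|lt_pl] := leqP l.+1 p; first by rewrite -size_s small ?size_s.
rewrite [LHS]/= -/(select_max p.+1 l.+1 _).
(* The extra entry [x] moves the start of the window by one, so both windows consist of the same p +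
   1 entries. *)
have -> : l.+2 - minn l.+2 p.+1 = (l - p).+1 by lia.
have e : l.+1 - minn l.+1 p.+1 = l - p by lia.
rewrite [select_max _ l.+1 s]/= e /=.
set w := drop (l - p) s; set a := \max_(b <- w) b; set s' := take (l - p) s ++ rem a w.
have size_w : size w = p.+1 by rewrite size_drop; lia.
have a_in : a \in w by apply: bigmax_mem; case: (w) size_w.
have size_s' : size s' = l.
  by rewrite size_cat size_rem // size_w size_takel; lia.
have := IHl _ size_s'; rewrite /= => ->.
(* Since p <= l, the final entry [a] lies beyond the first p entries and stays out of the pass. *)
rewrite /bubble_step -!cats1 takel_cat ?size_select_max ?drop_cat ?size_select_max; try lia.
rewrite -catA; congr (_ ++ _); case: ltnP => // le_lp.
have -> : p = l by lia.
by rewrite subnn drop0 drop_oversize ?size_select_max.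
Qed.

Lemma select_max_foldr p s :
  select_max p.+1 (size s) s = foldr (bubble_step p) [::] s.
Proof. by elim: s => // x s IHs; rewrite select_max_cons // IHs. Qed.

Lemma size_foldr_bubble p s : size (foldr (bubble_step p) [::] s) = size s.
Proof. by rewrite -select_max_foldr size_select_max. Qed.

End SelectMax.

(** * The word of sigma(lambda, SE) *)

Section Passes.
Variables n k m : nat.
Hypotheses (le_km : k <= m) (le_mn : m <= n) (lt_n : n < k + m).
Implicit Types (s u v w : seq nat) (i j q d x : nat).

(** A factor of the displayed word, with 0-based generators. The minimum unites its two families:
    the first has factors of length n - k, the second has factors starting with s_(m-1). *)
Definition pass i := rev (iota i (minn (n - k) (m.-1 - i))).
Definition passes i c := flatten [seq pass a | a <- iota i c].

Lemma passesS i c : passes i c.+1 = pass i ++ passes i.+1 c.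
Proof. by []. Qed.

Lemma map_predn_descending i :
  map predn (descending (minn (i.+1 + n - k - 1) (m - 1)) i.+1) = pass i.
Proof.
rewrite /descending /pass map_rev -add1n iotaDl -map_comp.
rewrite (eq_map (g := id)) ?map_id; last by [].
by congr (rev (iota _ _)); lia.
Qed.

Lemma sigma_indicesE : map predn (sigma_indices n k m) = passes 0 k.
Proof.
have -> : sigma_indices n k m
    = flatten [seq descending (minn (i + n - k - 1) (m - 1)) i | i <- iota 1 k].
  have -> : iota 1 k = iota 1 (k - (n - m) - 1) ++ iota (k - (n - m) + 0) (n - m).+1.
    by rewrite -[in RHS](_ : 1 + (k - (n - m) - 1) = k - (n - m) + 0) -?iotaD; last lia; congr iota; lia.
  rewrite map_cat flatten_cat iotaDl -map_comp /sigma_indices; congr (flatten _ ++ flatten _).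
    by apply/eq_in_map => i; rewrite mem_iota => lt_i; congr descending; lia.
  by apply/eq_in_map => i; rewrite mem_iota /= => lt_i; congr descending; lia.
rewrite /passes map_flatten -map_comp (iotaDl 1 0) -map_comp; congr flatten.
by apply: eq_map => i; apply: map_predn_descending.
Qed.

Lemma foldr_pmap_insub (T : Type) (op : 'I_n.-1 -> T -> T) z w :
  foldr op z (pmap (fun j => insub j.-1) w)
  = foldr (fun j => if insub j is Some r then op r else id) z (map predn w).
Proof. by elim: w => //= j w IHw; case: insub => [r|] /=; rewrite IHw. Qed.

Definition descent_at j (a : option 'X_{1..n}) :=
  if insub j is Some r then obind (descent_step r) a else a.

Lemma foldr_descent_at u x w v : size u + size w < n -> all (gtn x) w ->
  foldr descent_at (Some (compo n (u ++ x :: w ++ v))) (rev (iota (size u) (size w)))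
  = Some (compo n (u ++ w ++ x :: v)).
Proof.
elim: w u => // b w IHw u lt_u /= /andP[lt_bx lt_w].
rewrite rev_cons foldr_rcons.
have lt_r : size u < n.-1 by move: lt_u => /=; lia.
rewrite [descent_at (size u) _]/descent_at (insubT (fun i => i < n.-1) lt_r) /= /descent_step.
rewrite compo_lo compo_hi lt_bx mswap_compo -cat_rcons -(size_rcons u b) IHw //.
  by rewrite cat_rcons.
by rewrite size_rcons; move: lt_u => /=; lia.
Qed.

(** The last pass acts first. When pass i acts, the entry at position i is still the original one
    and exceeds all later entries, so every exchange is at a descent. For the staircase this lets
    [isobaric_perm_run] evaluate the displayed word. *)
Lemma foldr_descent_passes i c s : i + c = k -> size s = n -> pairwise gtn s ->
  exists2 w, perm_eq w (drop i s)
    & foldr descent_at (Some (compo n s)) (passes i c) = Some (compo n (take i s ++ w)).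
Proof.
move=> def_k size_s dec_s; elim: c i def_k => [|c IHc] i def_k.
  by exists (drop i s) => //; rewrite /= cat_take_drop.
have [|w prm_w foldr_w] := IHc i.+1; first by rewrite addSnnS.
have lt_i : i < size s by rewrite size_s; lia.
have size_w : size w = n - i.+1 by rewrite (perm_size prm_w) size_drop size_s.
rewrite passesS foldr_cat foldr_w (take_nth 0 lt_i) cat_rcons.
set x := nth 0 s i; set q := minn (n - k) (m.-1 - i).
have size_q : size (take q w) = q by rewrite size_takel // size_w /q; lia.
have size_i : size (take i s) = i by rewrite size_takel // ltnW.
have def_d : drop i s = x :: drop i.+1 s by rewrite (drop_nth 0 lt_i).
have lt_x : all (gtn x) w.
  rewrite (perm_all _ prm_w); move: dec_s; rewrite -{1}(cat_take_drop i s) pairwise_cat.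
  by rewrite def_d => /and3P[_ _ /=/andP[]].
exists (take q w ++ x :: drop q w).
  rewrite def_d perm_catC /= perm_cons perm_catC cat_take_drop.
  exact: prm_w.
have := @foldr_descent_at (take i s) x (take q w) (drop q w).
rewrite cat_take_drop size_i size_q => -> //; first by rewrite /q; lia.
by apply/allP => y /mem_take/(allP lt_x).
Qed.

Lemma isobaric_perm_sigma (f : {mpoly int[n]}) :
  isobaric_perm (sigma_SE n k m) f = foldr (@isob n) f (passes 0 k).
Proof.
rewrite /sigma_SE isobaric_perm_run.
  rewrite foldr_pmap_insub sigma_indicesE; elim: (passes 0 k) => //= j w ->.
  by rewrite /isob unlock; case: insub.
rewrite /run foldr_pmap_insub sigma_indicesE.
rewrite (_ : foldr _ _ _ = foldr descent_at (Some (staircase_mnm n)) (passes 0 k)); last first.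
  by elim: (passes 0 k) => //= j w ->; rewrite /descent_at; case: insub.
pose s := mkseq (fun i => n - i) n.
have -> : staircase_mnm n = compo n s.
  by apply/mnmP => i; rewrite compoE nth_mkseq // mnmE.
have [|w _ -> //] := @foldr_descent_passes 0 k s erefl (size_mkseq _ _).
apply/(pairwiseP 0) => i j; rewrite !inE size_mkseq => lt_i lt_j lt_ij.
by rewrite !nth_mkseq //=; lia.
Qed.

Lemma foldr_isob_bubble u x w v : size u + size w < n ->
  foldr (@isob n) (key (compo n (u ++ x :: w ++ v))) (rev (iota (size u) (size w)))
  = key (compo n (u ++ bubble x w ++ v)).
Proof.
elim: w u x => // b w IHw u x /= lt_u.
rewrite rev_cons foldr_rcons isob_key; last lia.
rewrite -cat_rcons -(size_rcons u (minn x b)) IHw ?cat_rcons //.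
by rewrite size_rcons; lia.
Qed.

(** Of the zeros that pad the exponent, m - k stand between the untouched entries and those already
    processed. Each pass carries one entry across these zeros and then bubbles it through at most n
    - m entries. *)
Lemma foldr_isob_passes i c s : i + c = k -> size s = k ->
  foldr (@isob n) (key (compo n s)) (passes i c)
  = key (compo n (take i s ++ nseq (m - k) 0 ++ foldr (bubble_step (n - m)) [::] (drop i s))).
Proof.
move=> def_k size_s; elim: c i def_k => [|c IHc] i def_k.
  by rewrite /= drop_oversize ?take_oversize ?size_s ?cats0 ?compo_cat0 //; lia.
have lt_i : i < size s by rewrite size_s; lia.
rewrite passesS foldr_cat IHc; last by rewrite addSnnS.
rewrite (take_nth 0 lt_i) cat_rcons (drop_nth 0 lt_i) /=.
set x := nth 0 s i; set V := foldr (bubble_step _) _ _.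
rewrite [bubble_step _ x V]/bubble_step.
have size_V : size V = k - i.+1 by rewrite size_foldr_bubble size_drop size_s.
have size_i : size (take i s) = i by rewrite size_takel // ltnW.
have := @foldr_isob_bubble (take i s) x (nseq (m - k) 0 ++ take (n - m) V) (drop (n - m) V).
rewrite -catA cat_take_drop bubble_nseq0 size_i size_cat size_nseq size_take_min size_V.
(* The length of the pass splits into the zeros crossed and the entries bubbled through. *)
rewrite /pass (_ : minn (n - k) (m.-1 - i) = m - k + minn (n - m) (k - i.+1)); last lia.
by rewrite -catA => -> //; lia.
Qed.

Lemma isobaric_perm_key mu : size mu = k ->
  isobaric_perm (sigma_SE n k m) (key (compo n (rev mu)))
  = key (compo n (nseq (m - k) 0 ++ alpha (n - m + 1) mu)).
Proof.
move=> size_mu; rewrite isobaric_perm_sigma foldr_isob_passes ?size_rev //.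
by rewrite take0 drop0 /alpha addn1 -(size_rev mu) select_max_foldr.
Qed.

Definition lam : pred (nat * nat) := fun c => [&& c.1 < k, c.2 < m & c.1 + c.2 < n].

(* The shape after the passes [i], ..., [k - 1]: pass [a] fills row [k - 1 - a]. *)
Definition rho_lam i : pred (nat * nat) := fun c =>
  (c.1 < k) && ([&& c.1 + i < k, c.2 < m & c.1 + c.2 < n] || (c.1 + c.2 < k)).

(** Row k - 1 - i of the staircase ends in column i, and each operator lengthens it by one cell. In
    the two columns exchanged, earlier rows are already full and later rows have no cell. *)
Lemma foldr_isob_kern_pass i q d : i < k -> q <= minn (n - k) (m.-1 - i) ->
  foldr (@isob (n + n)) (kern n (rho_lam i.+1) d) (map (addn n) (rev (iota i q)))
  = kern n (fun c => rho_lam i.+1 c || (c.1 == k - i.+1) && (c.2 <= i + q)) d.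
Proof.
move=> lt_i; elim: q => [|q IHq] le_q.
  apply: eq_kern => -[a b] _ /=; rewrite /rho_lam /=; lia.
have -> : rev (iota i q.+1) = i + q :: rev (iota i q) by rewrite -addn1 iotaD rev_cat.
rewrite /= IHq; last lia.
rewrite (isob_kern_y (i := k - i.+1)) /rho_lam /=; try lia.
by apply: eq_kern => -[a b] _; rewrite /= xpair_eqE; lia.
Qed.

Lemma foldr_isob_kern_passes i c d : i + c = k ->
  foldr (@isob (n + n)) (kern n (rho k) d) (map (addn n) (passes i c))
  = kern n (rho_lam i) d.
Proof.
elim: c i => [|c IHc] i def_k.
  by apply: eq_kern => -[a b] _; rewrite /rho /rho_lam /=; lia.
rewrite passesS map_cat foldr_cat IHc; last by rewrite addSnnS.
rewrite foldr_isob_kern_pass //; last lia.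
by apply: eq_kern => -[a b] _; rewrite /rho_lam /=; lia.
Qed.

Lemma all_passes : all (fun j => j.+1 < n) (passes 0 k).
Proof.
apply/allP => j /flattenP[_ /mapP[i _ ->]].
by rewrite mem_rev mem_iota; lia.
Qed.

End Passes.

(** * Power series *)

Section CauchyProduct.
Local Open Scope ring_scope.

Section Truncation.
Variable N : nat.
Implicit Types (p q c : {mpoly int[N]}) (mm : 'X_{1..N}).

Lemma mcoeff_homogM d p q mm : p \is d.-homog for mdeg -> (mdeg mm < d)%N ->
  (p * q)@_mm = 0.
Proof.
move=> hp lt_d; rewrite mcoeffM; apply: big1 => -[a b] /= _.
rewrite (dhomog_nemf_coeff hp) ?mul0r //= neq_ltn (leq_ltn_trans _ lt_d) //.
by rewrite -ltnS bmdeg.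
Qed.

(** Powers of [c] beyond the degree of [mm] do not contribute, so a bound [M] common to all
    monomials below it can be used. *)
Lemma fps_inv_mpoly M c mm : c \is 2.-homog for mdeg -> (mdeg mm <= M)%N ->
  fps_inv (fps_of_mpoly (1 - c)) mm = (\sum_(i < M.+1) c ^+ i)@_mm.
Proof.
move=> hc le_mM.
have iterE i m' : iter i (fps_mul (fun m'' => @fps_one N m'' - fps_of_mpoly (1 - c) m''))
    (@fps_one N) m' = (c ^+ i)@_m'.
  elim: i m' => [//|i IHi] m'; rewrite exprS /=; apply: fps_mul_mpoly => // m'' _.
  by rewrite /fps_one /fps_of_mpoly mcoeffB opprB addrC subrK.
rewrite /fps_inv raddf_sum /=.
rewrite (big_ord_widen M.+1
  (fun i => iter i (fps_mul (fun m'' => @fps_one N m'' - fps_of_mpoly (1 - c) m''))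
              (@fps_one N) mm)) ?ltnS //.
rewrite big_mkcond /=; apply: eq_bigr => i _; rewrite iterE.
case: ltnP => // le_mi; rewrite -[c ^+ i]mulr1 (@mcoeff_homogM (2 * i)) //.
  exact: dhomogMn.
by lia.
Qed.

Lemma hsym_homog e C d : {in C, forall c, c \is e.-homog for mdeg} ->
  hsym C d \is (e * d).-homog for mdeg.
Proof.
elim: C d => [|c C IHC] d hC.
  by case: d => [|d]; rewrite /= ?muln0 ?rpred0 ?dhomog1.
have [hc hC'] : c \is e.-homog for mdeg /\ {in C, forall c, c \is e.-homog for mdeg}.
  by split=> [|c' c'_in]; apply: hC; rewrite inE ?eqxx ?c'_in ?orbT.
rewrite /=; apply: rpred_sum => i _; have lt_i := ltn_ord i.
have -> : (e * d = e * i + e * (d - i))%N by rewrite -mulnDr subnKC.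
by apply: dhomogM (IHC _ hC'); apply: dhomogMn.
Qed.

(** Induction on the factors with truncated series: [def_Q] and [def_p] are the recurrence of [hsym]
    and the geometric sum, each with its boundary term. *)
Lemma big_fps_inv (I : eqType) (L : seq I) (t : I -> {mpoly int[N]}) M mm :
    {in L, forall a, t a \is 2.-homog for mdeg} -> (mdeg mm <= M)%N ->
  (\big[@fps_mul N/@fps_one N]_(a <- L) fps_inv (fps_of_mpoly (1 - t a))) mm
  = (\sum_(d < M.+1) hsym (map t L) d)@_mm.
Proof.
elim: L mm => [|a L IHL] mm hL le_mM.
  rewrite big_nil big_ord_recl big1 ?addr0 // => i _.
rewrite big_cons.
have [hc hL'] : t a \is 2.-homog for mdeg /\ {in L, forall a, t a \is 2.-homog for mdeg}.
  by split=> [|c' c'_in]; apply: hL; rewrite inE ?eqxx ?c'_in ?orbT.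
pose p := \sum_(i < M.+1) t a ^+ i; pose q := \sum_(d < M.+1) hsym (map t L) d.
rewrite (@fps_mul_mpoly _ _ _ p q); first last.
- by move=> m' le; apply: IHL => //; apply: leq_trans le_mM.
- by move=> m' le; apply: fps_inv_mpoly => //; apply: leq_trans le_mM.
set H := hsym (map t (a :: L)); pose Q := \sum_(d < M.+1) H d.
have hH : t a * H M \is (2 * M.+1).-homog for mdeg.
  rewrite mulnS; apply: dhomogM => //; apply: hsym_homog => _ /mapP[c' c'_in ->].
  exact: hL.
have def_Q : Q = q + t a * (Q - H M).
  have -> : Q - H M = \sum_(d < M) H d by rewrite /Q big_ord_recr addrK.
  rewrite {1}/Q (eq_bigr (fun d : 'I_M.+1 => hsym (map t L) d + t a * shift_seq 1 H d)).
    rewrite big_split /= -mulr_sumr; congr (_ + _ * _).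
    rewrite big_ord_recl {1}/shift_seq add0r; apply: eq_bigr => i _.
    by rewrite /shift_seq /= /bump /= add1n subn1.
  by move=> d _; rewrite /H map_cons hsym_cons.
have def_p : p * (1 - t a) = 1 - t a ^+ M.+1.
  by rewrite -opprB -[in RHS]opprB subrX1 mulrC mulNr.
(* Both error terms have a factor that is homogeneous of degree 2 (M + 1), which exceeds the degree
   of [mm]. *)
have -> : p * q = Q - t a ^+ M.+1 * Q + t a * H M * p.
  have -> : q = (1 - t a) * Q + t a * H M.
    by rewrite mulrBl mul1r {1}def_Q mulrBr; ring.
  by rewrite mulrDr (mulrA p (1 - _)) def_p mulrBl mul1r (mulrC p).
have hc' : t a ^+ M.+1 \is (2 * M.+1).-homog for mdeg by apply: dhomogMn.
by rewrite mcoeffD mcoeffB (mcoeff_homogM _ hc') ?(mcoeff_homogM _ hH) ?subr0 ?addr0 //; lia.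
Qed.

End Truncation.

Variable n : nat.

Lemma cell_ord (c : 'I_n * 'I_n) :
  in_x 'X_(c.1) * in_y 'X_(c.2) = cell n (val c.1, val c.2).
Proof.
rewrite in_xE in_yE !embedX /cell.
by rewrite (varX_ord (lshift n c.1)) (varX_ord (rshift n c.2)).
Qed.

Lemma cauchy_productE k m M mm : (mdeg mm <= M)%N ->
  cauchy_product n k m mm = (\sum_(d < M.+1) kern n (lam n k m) d)@_mm.
Proof.
move=> le_mM; rewrite /cauchy_product -big_filter.
set L := [seq c <- _ | _]; pose nat_pair (c : 'I_n * 'I_n) := (val c.1, val c.2).
have kE : kern n (lam n k m) =1 hsym [seq in_x 'X_(c.1) * in_y 'X_(c.2) | c <- L].
  move=> d; rewrite (eq_map (g := cell n \o nat_pair)) => [|c]; last exact: cell_ord.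
  rewrite map_comp; apply/hsym_perm/perm_map/uniq_perm => [||[a b]].
  - exact/filter_uniq/grid_uniq.
  - rewrite map_inj_uniq ?filter_uniq ?index_enum_uniq //.
    by move=> [a b] [a' b'] /= [/val_inj-> /val_inj->].
  rewrite mem_filter mem_grid /lam /=.
  apply/idP/mapP => [/and3P[/and3P[lt_ak lt_bm lt_n] lt_an lt_bn]|[[a' b']]].
    exists (Ordinal lt_an, Ordinal lt_bn) => //.
    by rewrite mem_filter mem_index_enum /in_lambda /=; lia.
  rewrite mem_filter /in_lambda /= => /andP[in_ab _] [-> ->].
  by have := ltn_ord a'; have := ltn_ord b'; lia.
rewrite (eq_bigr (fun d : 'I_M.+1 => hsym _ d) (fun d _ => kE d)).
apply: (big_fps_inv _ le_mM) => c _.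
by apply: (@in_xy_homog _ _ _ 1 1); rewrite dhomogX; apply/eqP; exact: mdeg1.
Qed.

(** The term of [mu] has degree twice the sum of [mu], so only finitely many terms meet a given
    monomial, and identities in each degree suffice. *)
Lemma has_sum_cauchy k0 k m (A B : seq nat -> {mpoly int[n]}) :
    (forall mu, size mu = k0 -> A mu \is (sumn mu).-homog for mdeg) ->
    (forall mu, size mu = k0 -> B mu \is (sumn mu).-homog for mdeg) ->
    (forall d, \sum_(mu <- comps k0 d) in_x (A mu) * in_y (B mu) = kern n (lam n k m) d) ->
  fps_has_sum (fun mu : k0.-tuple nat => fps_prod_xy (A mu) (B mu)) (cauchy_product n k m).
Proof.
move=> hA hB sumE mm; pose M := mdeg mm.
pose L := [seq mu | d <- iota 0 M.+1, mu <- comps k0 d].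
have mem_L mu : (mu \in L) = (size mu == k0) && (sumn mu <= M)%N.
  apply/allpairsPdep/andP => [[d [nu [d_in nu_in ->]]]|[size_mu le_mu]].
    move: d_in nu_in; rewrite mem_iota mem_comps => lt_d /andP[-> /eqP->].
    by split=> //; lia.
  by exists (sumn mu), mu; rewrite mem_iota mem_comps size_mu eqxx.
have L_uniq : uniq L.
  apply: allpairs_uniq_dep => [||[d mu] [d' mu']]; rewrite ?iota_uniq //.
    by move=> d _; apply: comps_uniq.
  move=> /allpairsPdep[d1 [mu1 [d_in mu_in e1]]].
  move=> /allpairsPdep[d2 [mu2 [d_in' mu_in' e2]]].
  have [] := (congr1 tag e1, congr1 (fun p : {_ : nat & seq nat} => tagged p) e1).
  have [] := (congr1 tag e2, congr1 (fun p : {_ : nat & seq nat} => tagged p) e2).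
  move=> /= -> -> -> -> eq_mu; move: mu_in mu_in'.
  by rewrite eq_mu !mem_comps => /andP[_ /eqP->] /andP[_ /eqP->].
exists (pmap insub L).
  split=> [|mu nz]; first exact: pmap_sub_uniq.
  rewrite mem_pmap_sub mem_L size_tuple eqxx /= leqNgt; apply: contraNN nz => lt_M.
  rewrite /fps_prod_xy /fps_of_mpoly (dhomog_nemf_coeff (in_xy_homog (hA mu _) (hB mu _)))
    ?size_tuple //=.
  by rewrite neq_ltn -/M (leq_trans lt_M) // leq_addr.
rewrite (cauchy_productE _ _ (leqnn _)) -/M.
have -> : \sum_(mu <- (pmap insub L : seq (k0.-tuple nat))) fps_prod_xy (A (val mu)) (B (val mu)) mm
        = \sum_(mu <- L) (in_x (A mu) * in_y (B mu))@_mm.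
  have map_val : map val (pmap insub L : seq (k0.-tuple nat)) = L.
    rewrite (pmap_filter (insubK _)) (eq_in_filter (a2 := xpredT)) ?filter_predT //.
    by move=> mu; rewrite mem_L => /andP[size_mu _]; rewrite /= insubT.
  by rewrite -{2}map_val big_map.
rewrite big_allpairs_dep raddf_sum /= -(big_mkord xpredT (fun d => (kern n (lam n k m) d)@_mm)).
by apply: eq_bigr => d _; rewrite -sumE raddf_sum.
Qed.

Lemma comps_eq (A B : seq nat -> {mpoly int[n + n]}) k d :
  (forall mu, size mu = k -> A mu = B mu) ->
  \sum_(mu <- comps k d) A mu = \sum_(mu <- comps k d) B mu.
Proof.
move=> eqAB; rewrite big_seq [RHS]big_seq; apply: eq_bigr => mu.
by rewrite mem_comps => /andP[/eqP/eqAB].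
Qed.

Lemma swap_alphabets_exists : exists S : 'S_(n + n),
  (forall i : 'I_n, S (lshift n i) = rshift n i) /\
  (forall i : 'I_n, S (rshift n i) = lshift n i).
Proof.
pose f (i : 'I_(n + n)) := match split i with
  | inl j => rshift n j | inr j => lshift n j end.
have fl (i : 'I_n) : f (lshift n i) = rshift n i by rewrite /f (unsplitK (inl i)).
have fr (i : 'I_n) : f (rshift n i) = lshift n i by rewrite /f (unsplitK (inr i)).
have f_inj : injective f.
  apply: (can_inj (g := f)) => i; rewrite -[i]splitK.
  by case: (split i) => j /=; rewrite ?fl ?fr.
by exists (perm f_inj); split=> i; rewrite permE.
Qed.

(** Exchanging the alphabets transposes the shape. *)
Lemma sum_swap (A B : seq nat -> {mpoly int[n]}) k d P Q :
    (forall i j, (i < n)%N -> (j < n)%N -> P (i, j) = Q (j, i)) ->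
  \sum_(mu <- comps k d) in_x (A mu) * in_y (B mu) = kern n P d ->
  \sum_(mu <- comps k d) in_x (B mu) * in_y (A mu) = kern n Q d.
Proof.
move=> PQ /= sumE; have [S [Sl Sr]] := swap_alphabets_exists.
have Sx f : msym S (in_x f) = in_y f by apply: msym_embed1.
have Sy f : msym S (in_y f) = in_x f by apply: msym_embed1.
transitivity (msym S (kern n P d)).
  rewrite -sumE (big_morph _ (msymD S) (msym0 _ S)); apply: eq_bigr => mu _.
  by rewrite msymM Sx Sy mulrC.
rewrite /kern rmorph_hsym -map_comp.
pose tr (c : nat * nat) := (c.2, c.1).
have trK : involutive tr by case.
have -> : [seq (msym S \o cell n) c | c <- grid n & P c]
        = [seq cell n c | c <- [seq tr c | c <- grid n & P c]].
  rewrite -map_comp; apply/eq_in_map => -[i j]; rewrite mem_filter mem_grid /=.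
  move=> /and3P[_ lt_i lt_j].
  rewrite -(cell_ord (Ordinal lt_i, Ordinal lt_j)) -(cell_ord (Ordinal lt_j, Ordinal lt_i)).
  by rewrite msymM Sx Sy mulrC.
apply/hsym_perm/perm_map/uniq_perm => [||[i j]].
- rewrite map_inj_uniq ?filter_uniq ?grid_uniq //; exact: inv_inj.
- exact/filter_uniq/grid_uniq.
rewrite -[(i, j) in LHS]trK mem_map; last exact: inv_inj.
rewrite !mem_filter !mem_grid /=.
case: (ltnP i n) => lt_i; case: (ltnP j n) => lt_j; rewrite ?andbF //.
by rewrite PQ.
Qed.

Section Shape.
Variables k m : nat.
Hypotheses (le_km : (k <= m)%N) (le_mn : (m <= n)%N) (lt_n : (n < k + m)%N).

Lemma sum_sigma_key d :
  \sum_(mu <- comps k d)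
     in_x (atom (compo n mu)) * in_y (isobaric_perm (sigma_SE n k m) (key (compo n (rev mu))))
  = kern n (lam n k m) d.
Proof.
rewrite -[RHS](_ : kern n (rho_lam n k m 0) d = _); last first.
  by apply: eq_kern => -[a b] _; rewrite /rho_lam /lam /=; lia.
rewrite -(foldr_isob_kern_passes le_km le_mn lt_n d (add0n k)).
rewrite -staircase_cauchy ?(leq_trans le_km) // foldr_isob_sum.
apply: eq_bigr => mu _; rewrite foldr_isob_in_y ?isobaric_perm_sigma //.
exact: all_passes.
Qed.

(** The staircase is its own transpose, so its identity also holds with atoms in y; the same word
    then acts on the atoms instead of the keys. *)
Lemma sum_sigma_atom d :
  \sum_(mu <- comps k d)
     in_x (key (compo n (rev mu))) * in_y (isobaric_perm (sigma_SE n k m) (atom (compo n mu)))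
  = kern n (lam n k m) d.
Proof.
rewrite -[RHS](_ : kern n (rho_lam n k m 0) d = _); last first.
  by apply: eq_kern => -[a b] _; rewrite /rho_lam /lam /=; lia.
rewrite -(foldr_isob_kern_passes le_km le_mn lt_n d (add0n k)).
rewrite -(sum_swap (P := rho k) (A := fun mu => atom (compo n mu))
            (B := fun mu => key (compo n (rev mu))) (k := k)); first last.
- by rewrite -staircase_cauchy // (leq_trans le_km).
- by move=> i j _ _; rewrite /rho /= addnC.
rewrite foldr_isob_sum.
apply: eq_bigr => mu _; rewrite foldr_isob_in_y ?isobaric_perm_sigma //.
exact: all_passes.
Qed.

Lemma sum_alpha d :
  \sum_(mu <- comps k d)
     in_x (atom (compo n mu)) * in_y (key (compo n (nseq (m - k) 0%N ++ alpha (n - m + 1) mu)))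
  = kern n (lam n k m) d.
Proof.
rewrite -sum_sigma_key; apply: comps_eq => mu size_mu.
by rewrite (isobaric_perm_key le_km le_mn lt_n size_mu).
Qed.

Lemma isobaric_perm_homog (s : 'S_n) f d :
  f \is d.-homog for mdeg -> isobaric_perm s f \is d.-homog for mdeg.
Proof.
rewrite /isobaric_perm => hf; elim: (xchoose _) => //= r w.
exact: isobaric_homog.
Qed.

Lemma atom_homog_size mu : size mu = k -> atom (compo n mu) \is (sumn mu).-homog for mdeg.
Proof. by move=> size_mu; apply: atom_homog; rewrite size_mu; lia. Qed.

Lemma key_rev_homog mu : size mu = k ->
  key (compo n (rev mu)) \is (sumn mu).-homog for mdeg.
Proof.
move=> size_mu; rewrite -sumn_rev.
by apply: key_homog; rewrite size_rev size_mu; lia.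
Qed.

(** The degree is read off the equal polynomial pi_sigma of a key, which avoids summing the entries
    of [alpha]. *)
Lemma key_alpha_homog mu : size mu = k ->
  key (compo n (nseq (m - k) 0%N ++ alpha (n - m + 1) mu)) \is (sumn mu).-homog for mdeg.
Proof.
move=> size_mu; rewrite -(isobaric_perm_key le_km le_mn lt_n size_mu).
exact/isobaric_perm_homog/key_rev_homog.
Qed.

End Shape.

Lemma lam_tr k m i j : lam n k m (i, j) = lam n m k (j, i).
Proof. by rewrite /lam /=; lia. Qed.

End CauchyProduct.

Theorem theorem6 (n k m : nat)
    (hk : 1 <= k <= n) (hm : 1 <= m <= n) (hkm : n + 1 <= m + k) :
  (k <= m ->
     fps_has_sum
       (fun mu : k.-tuple nat =>
          fps_prod_xy (atom (compo n mu))
            (isobaric_perm (sigma_SE n k m) (key (compo n (rev mu)))))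
       (cauchy_product n k m)
  /\ fps_has_sum
       (fun mu : k.-tuple nat =>
          fps_prod_xy (atom (compo n mu))
            (key (compo n (nseq (m - k) 0 ++ alpha (n - m + 1) mu))))
       (cauchy_product n k m))
  /\
  (m <= k ->
     fps_has_sum
       (fun mu : m.-tuple nat =>
          fps_prod_xy (isobaric_perm (sigma_NW n k m) (atom (compo n mu)))
            (key (compo n (rev mu))))
       (cauchy_product n k m)
  /\ fps_has_sum
       (fun mu : m.-tuple nat =>
          fps_prod_xy (isobaric_perm (sigma_NW n k m) (key (compo n (rev mu))))
            (atom (compo n mu)))
       (cauchy_product n k m)
  /\ fps_has_sum
       (fun mu : m.-tuple nat =>
          fps_prod_xy
            (key (compo n (nseq (k - m) 0 ++ alpha (n - k + 1) mu)))
            (atom (compo n mu)))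
       (cauchy_product n k m)).
Proof.
have [[_ le_kn] [_ le_mn]] := (andP hk, andP hm).
split=> [le_km|le_mk].
  have lt_n : n < k + m by lia.
  split.
    apply: (has_sum_cauchy (A := fun mu => atom (compo n mu))
      (B := fun mu => isobaric_perm _ (key (compo n (rev mu))))) => [mu|mu|d] //.
    - exact: (atom_homog_size le_km le_mn).
    - by move=> size_mu; apply/isobaric_perm_homog/(key_rev_homog le_km le_mn).
    exact: (sum_sigma_key le_km le_mn lt_n).
  apply: (has_sum_cauchy (A := fun mu => atom (compo n mu))
    (B := fun mu => key (compo n (nseq (m - k) 0 ++ alpha (n - m + 1) mu))))
    => [mu|mu|d].
  - exact: (atom_homog_size le_km le_mn).
  - exact: (key_alpha_homog le_km le_mn lt_n).
  exact: (sum_alpha le_km le_mn lt_n).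
have lt_n : n < m + k by lia.
(* The second part follows from the conjugate shape, with k and m exchanged, by exchanging the
   alphabets; [sigma_NW n k m] is [sigma_SE n m k] by definition. *)
have tr i j : i < n -> j < n -> lam n m k (i, j) = lam n k m (j, i).
  by move=> _ _; apply: lam_tr.
split; last split.
- apply: (has_sum_cauchy (A := fun mu => isobaric_perm _ (atom (compo n mu)))
    (B := fun mu => key (compo n (rev mu)))) => [mu|mu|d].
  + by move=> size_mu; apply/isobaric_perm_homog/(atom_homog_size le_mk le_kn).
  + exact: (key_rev_homog le_mk le_kn).
  exact: (sum_swap tr (sum_sigma_atom le_mk le_kn lt_n d)).
- apply: (has_sum_cauchy (A := fun mu => isobaric_perm _ (key (compo n (rev mu))))
    (B := fun mu => atom (compo n mu))) => [mu|mu|d].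
  + by move=> size_mu; apply/isobaric_perm_homog/(key_rev_homog le_mk le_kn).
  + exact: (atom_homog_size le_mk le_kn).
  exact: (sum_swap tr (sum_sigma_key le_mk le_kn lt_n d)).
apply: (has_sum_cauchy
  (A := fun mu => key (compo n (nseq (k - m) 0 ++ alpha (n - k + 1) mu)))
  (B := fun mu => atom (compo n mu))) => [mu|mu|d].
- exact: (key_alpha_homog le_mk le_kn lt_n).
- exact: (atom_homog_size le_mk le_kn).
exact: (sum_swap tr (sum_alpha le_mk le_kn lt_n d)).
Qed.
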